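(* Let $N\ge 2$, $0<\ell<N$, $0\le\alpha<1$, and let $\beta\in\mathbb{R}$ and $1\le q<\infty$ satisfy $\beta<N/q$, $\alpha+\beta>0$ and $\frac1q=1+\frac{\alpha+\beta-\ell}{N}$. Let $L(D)$ be a homogeneous linear differential operator of order $m$ on $\mathbb{R}^N$ with constant coefficients from $F$ to $V$, where $F,V$ are finite dimensional complex vector spaces. (1) If $L(D)$ is cocanceling, then there exists $C>0$ such that $$\left(\int_{\mathbb{R}^N}|I_\ell f(x)|^q\,|x|^{-\beta q}\,dx\right)^{1/q}\le C\int_{\mathbb{R}^N}|x|^\alpha|f(x)|\,dx \qquad ( * )$$ for all $f\in C_c^\infty(\mathbb{R}^N;F)$ such that $L(D)f=0$ in the sense of distributions. (2) Conversely, if $\alpha=0$ and there is a constant $C>0$ such that $( * )$ holds for all $f\in C_c^\infty(\mathbb{R}^N;F)$ satisfying $L(D)f=0$, then $L(D)$ is cocanceling.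
   Context: For $0<\ell<N$ the Riesz potential is $I_\ell f(x)=\gamma_{N,\ell}\int_{\mathbb{R}^N}\frac{f(y)}{|x-y|^{N-\ell}}\,dy$ with $\gamma_{N,\ell}=\pi^{\ell-N/2}\,\Gamma((N-\ell)/2)/\Gamma(\ell/2)$ (applied componentwise to vector-valued $f$). A homogeneous linear differential operator of order $m$ with constant coefficients from $F$ to $V$ has the form $L(D)=\sum_{|\gamma|=m}b_\gamma\partial^\gamma$ with $b_\gamma\in\mathcal{L}(F,V)$; its symbol is $L(\xi)=\sum_{|\gamma|=m}b_\gamma\xi^\gamma$ (up to a nonzero scalar factor). $L(D)$ is called cocanceling if $\bigcap_{\xi\in\mathbb{R}^N\setminus\{0\}}\ker L(\xi)=\{0\}$. The spaces $F,V$ are identified with Euclidean spaces with their usual norms. *)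

(* Defs.v *)
From HB Require Import structures.
From mathcomp Require Import all_boot all_order all_algebra.
From mathcomp Require Import all_classical all_reals all_analysis.
From mathcomp Require Import complex.
Set Implicit Arguments.
Unset Strict Implicit.
Unset Printing Implicit Defensive.
Import Order.TTheory GRing.Theory Num.Theory.
Import numFieldNormedType.Exports.
Local Open Scope classical_set_scope.
Local Open Scope ring_scope.

Definition measure_rV_display : measure_display -> measure_display.
Proof. exact. Qed.

(* Row vectors carry the product sigma-algebra, generated by the coordinate
   maps; over R it is the Borel sigma-algebra. *)
Section measurable_rV.
Context {d} {T : measurableType d}.
Variable n : nat.

Let coors : 'I_n -> 'rV[T]_n -> T := fun i x => x ord0 i.

Let rV_set0 : g_sigma_preimage coors set0.
Proof. exact: sigma_algebra0. Qed.

Let rV_setC A : g_sigma_preimage coors A -> g_sigma_preimage coors (~` A).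
Proof. exact: sigma_algebraC. Qed.

Let rV_bigcup (F : _^nat) : (forall i, g_sigma_preimage coors (F i)) ->
  g_sigma_preimage coors (\bigcup_i (F i)).
Proof. exact: sigma_algebra_bigcup. Qed.

HB.instance Definition _ := @isMeasurable.Build (measure_rV_display d)
  'rV[T]_n (g_sigma_preimage coors) rV_set0 rV_setC rV_bigcup.

End measurable_rV.

Section measurable_rV_theory.
Context {d} {T : measurableType d}.

Lemma measurable_coord n (i : 'I_n) :
  measurable_fun [set: 'rV[T]_n] (fun x : 'rV[T]_n => x ord0 i).
Proof.
move=> _ Y mY; rewrite setTI; apply: sub_sigma_algebra => /=.
rewrite -bigcup_seq/=; exists i => /=; first by rewrite mem_index_enum.
by exists Y => //; rewrite setTI.
Qed.

Lemma measurable_fun_coordP d1 (T1 : measurableType d1) n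
    (f : T1 -> 'rV[T]_n) :
  (forall i, measurable_fun [set: T1] (fun x => f x ord0 i)) ->
  measurable_fun [set: T1] f.
Proof.
move=> mf _ A mA; rewrite setTI.
suff : preimage_set_system [set: T1] f
    (g_sigma_preimage (fun (i : 'I_n) (x : 'rV[T]_n) => x ord0 i))
    `<=` measurable.
  by apply; exists A => //; rewrite setTI.
rewrite -g_sigma_preimage_comp.
apply: smallest_sub; first exact: sigma_algebra_measurable.
case: n => [|n] in f mf A mA *; first by rewrite big_ord0.
rewrite -bigcup_mkord_ord; apply: bigcup_sub => i Ii.
by move=> B [C mC <-]; exact: mf.
Qed.

End measurable_rV_theory.

Section cons_rV.
Context {d} {T : measurableType d}.

Definition cons_rV n (x : T) (v : 'rV[T]_n) : 'rV[T]_n.+1 :=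
  \row_i oapp (v ord0) x (unlift ord0 i).

Lemma cons_rV0 n (x : T) (v : 'rV[T]_n) : cons_rV x v ord0 ord0 = x.
Proof. by rewrite mxE unlift_none. Qed.

Lemma cons_rVS n (x : T) (v : 'rV[T]_n) i :
  cons_rV x v ord0 (lift ord0 i) = v ord0 i.
Proof. by rewrite mxE liftK. Qed.

Lemma measurable_cons_rV n :
  measurable_fun [set: T * 'rV[T]_n] (fun p => cons_rV p.1 p.2).
Proof.
apply: measurable_fun_coordP => i.
case: (unliftP ord0 i) => [j ->|->].
- under eq_fun do rewrite cons_rVS.
  by apply: (measurableT_comp (measurable_coord j)); exact: measurable_snd.
- under eq_fun do rewrite cons_rV0.
  exact: measurable_fst.
Qed.

Lemma measurable_behead_rV n :
  measurable_fun [set: 'rV[T]_n.+1]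
    (fun v : 'rV[T]_n.+1 => \row_i v ord0 (lift ord0 i) : 'rV[T]_n).
Proof.
apply: measurable_fun_coordP => i; under eq_fun do rewrite mxE.
exact: measurable_coord.
Qed.

End cons_rV.

Section lebesgue_rV.
Variable R : realType.

Fixpoint lebesgue_rV n : set 'rV[R]_n -> \bar R :=
  match n with
  | 0 => fun A => \d_(0 : 'rV[R]_0) A
  | n'.+1 => fun A =>
      (\int[lebesgue_measure]_x lebesgue_rV (cons_rV x @^-1` A))%E
  end.

Section lebesgue_rV_step.
Variables (n : nat) (mu : {sigma_finite_measure set 'rV[R]_n -> \bar R}).

Local Notation prod := (@lebesgue_measure R \x mu)%E.
Let cons (p : measurableTypeR R * 'rV[R]_n) : 'rV[R]_n.+1 := cons_rV p.1 p.2.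
Let step : set 'rV[R]_n.+1 -> \bar R := pushforward prod cons.

Let mcons : measurable_fun [set: _] cons := @measurable_cons_rV _ R n.

Let step0 : step set0 = 0%E.
Proof. by rewrite /step /pushforward preimage_set0 measure0. Qed.

Let step_ge0 A : (0 <= step A)%E.
Proof. exact: measure_ge0. Qed.

Let step_sigma_additive : semi_sigma_additive step.
Proof. by apply: measure_semi_sigma_additive. Qed.

HB.instance Definition _ := isMeasure.Build _ _ _ step
  step0 step_ge0 step_sigma_additive.

Let step_sigma_finite : sigma_finite setT step.
Proof.
have /sigma_finiteP[F [TF ndF Foo]] := sigma_finiteT (@lebesgue_measure R).
have /sigma_finiteP[G [TG ndG Goo]] := sigma_finiteT mu.
pose behead (v : 'rV[R]_n.+1) : 'rV[R]_n := \row_i v ord0 (lift ord0 i).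
have consK x v : behead (cons (x, v)) = v.
  by apply/rowP => i; rewrite mxE cons_rVS.
exists (fun k => [set v : 'rV[R]_n.+1 | F k (v ord0 ord0) /\ G k (behead v)]).
  apply/esym; rewrite -subTset => v _.
  have : [set: measurableTypeR R] (v ord0 ord0) by [].
  rewrite TF => -[i _ Fi].
  have : [set: 'rV[R]_n] (behead v) by [].
  rewrite TG => -[j _ Gj].
  exists (maxn i j) => //; split => /=.
  - by move: Fi; exact/subsetPset/ndF/leq_maxl.
  - by move: Gj; exact/subsetPset/ndG/leq_maxr.
move=> k; have [mF Fk] := Foo k; have [mG Gk] := Goo k; split.
  apply: measurableI; rewrite -[X in measurable X]setTI.
  - exact: (@measurable_coord _ R n.+1 ord0).
  - exact: (@measurable_behead_rV _ R n).
rewrite /step /pushforward (_ : _ @^-1` _ = F k `*` G k).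
  by rewrite product_measure1E// lte_mul_pinfty// ge0_fin_numE.
apply/seteqP; split => -[x v]; rewrite /preimage/= consK cons_rV0; exact.
Qed.

HB.instance Definition _ := @Measure_isSigmaFinite.Build _ _ _ step
  step_sigma_finite.

Lemma lebesgue_rV_stepE :
  exists nu : {sigma_finite_measure set 'rV[R]_n.+1 -> \bar R},
    nu = (fun A => \int[lebesgue_measure]_x mu (cons_rV x @^-1` A))%E
      :> (set 'rV[R]_n.+1 -> \bar R).
Proof.
exists step; apply/funext => A.
rewrite /= /step /pushforward /product_measure1/=.
apply: eq_integral => x _; congr (mu _); apply/funext => v.
by rewrite xsectionE.
Qed.

End lebesgue_rV_step.

Lemma lebesgue_rVE n :
  exists mu : {sigma_finite_measure set 'rV[R]_n -> \bar R},
    @lebesgue_rV n = mu :> (set 'rV[R]_n -> \bar R).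
Proof.
elim: n => [|n [mu muE]]; first by exists (dirac (0 : 'rV[R]_0)).
have [nu nuE] := lebesgue_rV_stepE mu.
by exists nu; rewrite nuE /= muE.
Qed.

Section lebesgue_rV_measure.
Variable n : nat.

Let lebesgue_rV0 : lebesgue_rV (set0 : set 'rV[R]_n) = 0%E.
Proof. by have [mu ->] := lebesgue_rVE n; exact: measure0. Qed.

Let lebesgue_rV_ge0 (A : set 'rV[R]_n) : (0 <= lebesgue_rV A)%E.
Proof. by have [mu ->] := lebesgue_rVE n; exact: measure_ge0. Qed.

Let lebesgue_rV_sigma_additive : semi_sigma_additive (@lebesgue_rV n).
Proof.
by have [mu ->] := lebesgue_rVE n; exact: measure_semi_sigma_additive.
Qed.

HB.instance Definition _ := isMeasure.Build _ _ _ (@lebesgue_rV n)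
  lebesgue_rV0 lebesgue_rV_ge0 lebesgue_rV_sigma_additive.

Let lebesgue_rV_sigma_finite : sigma_finite setT (@lebesgue_rV n).
Proof. by have [mu ->] := lebesgue_rVE n; exact: sigma_finiteT. Qed.

HB.instance Definition _ := @Measure_isSigmaFinite.Build _ _ _ (@lebesgue_rV n)
  lebesgue_rV_sigma_finite.

End lebesgue_rV_measure.

Lemma lebesgue_rV_box n (A : 'I_n -> set R) :
  (forall i, measurable (A i)) ->
  lebesgue_rV [set v : 'rV[R]_n | forall i, A i (v ord0 i)]
  = (\prod_(i < n) lebesgue_measure (A i))%E.
Proof.
elim: n A => [|n IHn] A mA.
  by rewrite /= big_ord0 diracE mem_set// => -[].
rewrite big_ord_recl /= -IHn; last by move=> i; exact: mA.
set B := [set v : 'rV[R]_n | _].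
transitivity (\int[lebesgue_measure]_(x in A ord0) lebesgue_rV B)%E; last first.
  by rewrite integral_cst; [exact: muleC|exact: mA].
rewrite [RHS]integral_mkcond; apply: eq_integral => x _.
rewrite patchE; case: ifPn => [|/negP] xA.
  rewrite inE in xA; congr (lebesgue_rV _); apply/seteqP; split=> v /= Av i.
    by have := Av (lift ord0 i); rewrite cons_rVS.
  by case: (unliftP ord0 i) => [j ->|->]; rewrite ?cons_rVS ?cons_rV0.
rewrite (_ : _ @^-1` _ = set0) ?measure0//.
apply/seteqP; split => // v /= /(_ ord0); rewrite cons_rV0 => Ax.
by apply: xA; rewrite inE.
Qed.

End lebesgue_rV.

Section euclidean.
Variable R : realType.

(* The norm that mathcomp-analysis puts on 'rV[R]_n is the sup norm, hence the
   explicit Euclidean norms; C^k is normed as R^(2k). *)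
Definition enorm n (x : 'rV[R]_n) : R := Num.sqrt (\sum_(i < n) x ord0 i ^+ 2).

Definition cnorm k (z : 'cV[R[i]]_k) : R :=
  Num.sqrt (\sum_(j < k)
    (complex.Re (z j ord0) ^+ 2 + complex.Im (z j ord0) ^+ 2)).

End euclidean.

Section complex_integral.
Variables (R : realType) (n : nat).

Definition cintegral (g : 'rV[R]_n -> R[i]) : R[i] :=
  ((\int[@lebesgue_rV R n]_x complex.Re (g x)) +i*
   (\int[@lebesgue_rV R n]_x complex.Im (g x)))%C.

Definition vintegral k (f : 'rV[R]_n -> 'cV[R[i]]_k) : 'cV[R[i]]_k :=
  \col_j cintegral (fun x => f x j ord0).

End complex_integral.

Section riesz_potential.
Variables (R : realType) (n : nat).

Definition gamma_fun (s : R) : R :=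
  \int[@lebesgue_measure R]_(t in `]0, +oo[) (t `^ (s - 1) * expR (- t)).

Definition riesz_const (l : R) : R :=
  pi `^ (l - n%:R / 2) * gamma_fun ((n%:R - l) / 2) / gamma_fun (l / 2).

Definition riesz_potential (l : R) k (f : 'rV[R]_n -> 'cV[R[i]]_k)
    (x : 'rV[R]_n) : 'cV[R[i]]_k :=
  (riesz_const l)%:C%C *:
    vintegral (fun y => ((enorm (x - y) `^ (n%:R - l))^-1)%:C%C *: f y).

End riesz_potential.

Section test_functions.
Variables (R : realType) (n : nat).

Fixpoint partials (s : seq 'I_n) (g : 'rV[R]_n -> R) : 'rV[R]_n -> R :=
  if s is i :: s' then fun x => 'D_(delta_mx ord0 i) (partials s' g) x else g.

Definition rsmooth (g : 'rV[R]_n -> R) : Prop :=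
  forall s : seq 'I_n, continuous (partials s g) /\
    forall (i : 'I_n) (x : 'rV[R]_n),
      derivable (partials s g) x (delta_mx ord0 i).

Definition csmooth (g : 'rV[R]_n -> R[i]) : Prop :=
  rsmooth (fun x => complex.Re (g x)) /\ rsmooth (fun x => complex.Im (g x)).

Definition compact_support (W : nmodType) (g : 'rV[R]_n -> W) : Prop :=
  compact (closure [set x | g x != 0]).

Definition test_fun (g : 'rV[R]_n -> R[i]) : Prop :=
  csmooth g /\ compact_support g.

Definition vtest_fun k (f : 'rV[R]_n -> 'cV[R[i]]_k) : Prop :=
  (forall j, csmooth (fun x => f x j ord0)) /\ compact_support f.

End test_functions.

Section differential_operators.
Variables (R : realType) (n m : nat).

Definition multiindex : Type :=
  {g : {ffun 'I_n -> 'I_m.+1} | (\sum_(i < n) g i == m)%N}.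

Definition directions (g : multiindex) : seq 'I_n :=
  flatten [seq nseq (val g i) i | i <- enum 'I_n].

Definition mpartial (g : multiindex) (phi : 'rV[R]_n -> R[i]) (x : 'rV[R]_n) :
    R[i] :=
  ((partials (directions g) (fun y => complex.Re (phi y)) x) +i*
   (partials (directions g) (fun y => complex.Im (phi y)) x))%C.

Variables p k : nat.

(* The operator L(D) = \sum_(|g| = m) b_g d^g from C^k to C^p, given by its
   coefficients. *)
Definition diff_op : Type := multiindex -> 'M[R[i]]_(p, k).

Definition symbol (L : diff_op) (xi : 'rV[R]_n) : 'M[R[i]]_(p, k) :=
  \sum_(g : multiindex) (\prod_(i < n) xi ord0 i ^+ val g i)%:C%C *: L g.

Definition cocanceling (L : diff_op) : Prop :=
  \bigcap_(xi in [set xi : 'rV[R]_n | xi != 0])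
    [set v : 'cV[R[i]]_k | symbol L xi *m v = 0] = [set 0].

(* L(D) f = 0 as a V-valued distribution:
   <L(D) f, phi> = (-1)^m \sum_g b_g \int f d^g phi. *)
Definition distr_null (L : diff_op) (f : 'rV[R]_n -> 'cV[R[i]]_k) : Prop :=
  forall phi : 'rV[R]_n -> R[i], test_fun phi ->
    (-1) ^+ m *: (\sum_(g : multiindex)
      L g *m vintegral (fun x => mpartial g phi x *: f x)) = 0.

End differential_operators.

Section estimate.
Variables (R : realType) (n k : nat).
Local Open Scope ereal_scope.

Definition weighted_riesz_estimate (l alpha beta q C : R)
    (f : 'rV[R]_n -> 'cV[R[i]]_k) : Prop :=
  (\int[@lebesgue_rV R n]_x
     (cnorm (riesz_potential l f x) `^ q * enorm x `^ (- (beta * q)))%:E)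
     `^ q^-1
  <= C%:E * \int[@lebesgue_rV R n]_x (enorm x `^ alpha * cnorm (f x))%:E.

End estimate.

(* Main.v *)
(* Let b = N - l. If L(D) is cocanceling, the coefficients of L have a left
   inverse, so testing L(D) f = 0 against monomials times a plateau function of
   radius r bounds the localized mean of f over |y| <= r by the mass of |f| in
   the annulus r/2 <= |y| <= r. Subtracting |x|^-b times that mean, with r
   comparable to |x|, from the Riesz potential leaves a kernel which gains a
   factor |y|/|x| for |y| much smaller than |x|; since alpha < 1 and
   alpha + beta > 0, Hoelder's inequality with suitable weights followed by
   Tonelli's theorem gives the weighted estimate.
   If L(D) is not cocanceling, some v <> 0 is killed by every coefficient of L,
   so f = chi v satisfies L(D) f = 0 for each plateau function chi. Its
   potential is at least c |x|^-b at infinity, and the integrand on the left is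
   at least a multiple of |x|^-N, which is not integrable. *)
Require Import Defs.
From mathcomp Require Import all_boot all_order all_algebra.
From mathcomp Require Import all_classical all_reals all_analysis.
From mathcomp Require Import measurable_realfun complex ring lra.
Set Implicit Arguments.
Unset Strict Implicit.
Unset Printing Implicit Defensive.
Import Order.TTheory GRing.Theory Num.Theory.
Import numFieldNormedType.Exports.
Local Open Scope classical_set_scope.
Local Open Scope ring_scope.

(** * Smooth plateau functions on the line *)

(** Balls, annuli and cutoffs are taken in the sup norm: a ball is then a box of known measure, and
    test functions are products of one-variable functions with explicit partial derivatives. The
    Euclidean norm stays in the Riesz kernel and in the weights, and is traded for the sup norm at
    the price of constants depending on the dimension. The exponent relation is used as N = q (b +
    alpha + beta). In this form b q < N says alpha + beta > 0, and (b + 1) q + beta q > N says alpha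
    < 1. Together with beta q < N these make the q-th power of the remainder kernel, weighted by
    |x|^-(beta q), integrable in x near y, at infinity and at the origin. By scaling the integral is
    a multiple of |y|^(alpha q), the condition needed for a Schur estimate with weight |y|^alpha.
    The localized mean need not vanish. Its annulus is where |y| is comparable to |x|, so the bound
    on the mean is absorbed by the same remainder kernel. In the converse, a vector killed by every
    L(xi) is killed by every coefficient because the monomials of degree m are linearly independent
    as functions of xi. *)

Section one_variable.
Context {R : realType}.
Implicit Types (f g : R -> R) (n k : nat).

(** A chain of explicit derivatives, so that closure properties are plain inductions. The last link
    carries no continuity; this is harmless since the functions of interest are shown to satisfy
    [Cn n] for every [n]. *)
Fixpoint Cn n f : Prop :=
  if n is n'.+1 then
    exists2 g : R -> R, (forall t : R, is_derive t 1 f (g t)) & Cn n' g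
  else True.

Lemma CnW n f : Cn n.+1 f -> Cn n f.
Proof.
elim: n f => // n IHn f [g fg Cg]; exists g => //.
exact: IHn.
Qed.

Lemma Cn_cst n (c : R) : Cn n (cst c).
Proof.
elim: n c => // n IHn c; exists (cst 0); last exact: IHn.
by move=> t; exact: is_derive_cst.
Qed.

Lemma CnD n f g : Cn n f -> Cn n g -> Cn n (fun t => f t + g t).
Proof.
elim: n f g => // n IHn f g [f' df Cf] [g' dg Cg].
exists (fun t => f' t + g' t); last exact: IHn.
by move=> t; exact: (is_deriveD (df t) (dg t)).
Qed.

Lemma CnM n f g : Cn n f -> Cn n g -> Cn n (fun t => f t * g t).
Proof.
elim: n f g => // n IHn f g Cf Cg.
have [f' df Cf'] := Cf; have [g' dg Cg'] := Cg.
exists (fun t => f t * g' t + g t * f' t).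
  by move=> t; exact: (is_deriveM (df t) (dg t)).
by apply: CnD; apply: IHn => //; exact: CnW.
Qed.

Lemma CnV n f : (forall t, f t != 0) -> Cn n f -> Cn n (fun t => (f t)^-1).
Proof.
move=> f0; elim: n => // n IHn Cf.
have [f' df Cf'] := Cf; exists (fun t => - 1 * ((f t)^-1 * (f t)^-1) * f' t).
  move=> t; apply: is_derive_eq (is_deriveV (f0 t) (df t)) _.
  by rewrite mulN1r -invfM -expr2.
apply: CnM => //; apply: CnM; first exact: Cn_cst.
by apply: CnM; apply: IHn; exact: CnW.
Qed.

Lemma is_derive_affine (a b t : R) : is_derive t (1 : R) (fun t => a * t + b) a.
Proof.
have -> : (fun t => a * t + b) = a *: id + cst b :> (R -> R) by [].
by apply: is_derive_eq; rewrite addr0 /GRing.scale/= mulr1.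
Qed.

Lemma Cn_affine n f (a b : R) : Cn n f -> Cn n (fun t => f (a * t + b)).
Proof.
elim: n f => // n IHn f [f' df Cf'].
exists (fun t => f' (a * t + b) * a); last first.
  by apply: CnM; [exact: IHn|exact: Cn_cst].
move=> t; apply: (@is_derive1_comp _ f (fun t => a * t + b)).
exact: is_derive_affine.
Qed.

Lemma Cn_id n : Cn n (@id R).
Proof.
case: n => // n; exists (cst 1); last exact: Cn_cst.
by move=> t; exact: is_derive_id.
Qed.

Lemma CnX n k f : Cn n f -> Cn n (fun t => f t ^+ k).
Proof.
move=> Cf; elim: k => [|k IHk].
  by under eq_fun do rewrite expr0; exact: Cn_cst.
by under eq_fun do rewrite exprS; exact: CnM.
Qed.

Lemma Cn_derive1n n f : Cn n.+1 f -> forall t : R, is_derive t 1 (derive1n n f) (derive1n n.+1 f t).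
Proof.
elim: n f => [|n IHn] f [f' df Cf] t.
  by rewrite derive1n0 derive1n1 derive1E; apply: derivableP; case: (df t).
rewrite (derive1Sn f n.+1) (derive1Sn f n).
have -> : derive1 f = f' by apply/funext => u; rewrite derive1E derive_val.
exact: IHn.
Qed.

(** The factor t^-k in front of exp(-1/t) makes the family closed under differentiation: the
    derivative of [flat k] is a combination of [flat k.+1] and [flat k.+2]. *)
Definition flat k (t : R) := if 0 < t then t^-1 ^+ k * expR (- t^-1) else 0.

Lemma flat_ge0 k t : 0 <= flat k t.
Proof.
by rewrite /flat; case: ifPn => // t0; rewrite mulr_ge0 ?expR_ge0// exprn_ge0 ?invr_ge0// ltW.
Qed.

(** With s = 1/t, the term of degree k + 1 of the exponential series gives exp(s) >= s^(k+1) /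
    (k+1)!, one power more than needed to compensate s^k. The spare power is the factor |t|, which
    yields continuity at 0. *)
Lemma flat_le k t : `|flat k t| <= k.+1`!%:R * `|t|.
Proof.
rewrite ger0_norm ?flat_ge0// /flat; case: ifPn => [t0|_]; last exact: mulr_ge0.
rewrite (gtr0_norm t0) expRN ler_pdivrMr ?expR_gt0// mulrAC -ler_pdivrMr//.
have ti : 0 < t^-1 by rewrite invr_gt0.
rewrite -exprSr mulrC -ler_pdivrMr ?ltr0n ?fact_gt0//.
apply: le_trans (@expR_ge1Dxn R t^-1 k (ltW ti)).
by rewrite lerDr.
Qed.

Lemma flat_continuous0 k : {for 0, continuous (flat k)}.
Proof.
rewrite /prop_for /continuous_at {2}/flat ltxx.
apply/cvgrPdist_le => e e0; rewrite nearE /=.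
apply/nbhs_ballP; exists (e / k.+1`!%:R) => /=.
  by rewrite divr_gt0// ltr0n fact_gt0.
move=> t; rewrite /ball/= sub0r normrN => /ltW te.
rewrite sub0r normrN (le_trans (flat_le k t))//.
by rewrite mulrC -ler_pdivlMr// ltr0n fact_gt0.
Qed.

Lemma is_derive_flat k (t : R) :
  is_derive t (1 : R) (flat k) (- k%:R * flat k.+1 t + flat k.+2 t).
Proof.
have [t0|t0|->] := ltgtP t 0.
- have -> : - k%:R * flat k.+1 t + flat k.+2 t = 0.
    by rewrite /flat ltNge (ltW t0)/= mulr0 addr0.
  apply: (@near_eq_is_derive _ _ _ (cst 0)) => //.
  near=> u; rewrite /flat ifF//; apply/negbTE; rewrite -leNgt ltW//.
  by near: u; exact: lt_nbhsl.
- pose h u : R := u^-1 ^+ k * expR (- u^-1).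
  apply: (@near_eq_is_derive _ _ _ h).
    by near=> u; rewrite /flat ifT//; near: u; exact: lt_nbhsr.
  have dV : is_derive t (1 : R) (fun u : R => u^-1) (- t^-1 ^+ 2).
    have t0' : @id R t != 0 by rewrite gt_eqF.
    apply: is_derive_eq (is_deriveV t0' (is_derive_id t (1 : R))) _.
    by rewrite /GRing.scale/= mulr1 exprVn.
  have dE : is_derive t (1 : R) (fun u : R => expR (- u^-1)) (expR (- t^-1) * t^-1 ^+ 2).
    apply: (@is_derive1_comp _ expR (fun u => - u^-1)).
    by apply: is_derive_eq (is_deriveN dV) _; rewrite opprK.
  have dX := is_deriveX k dV.
  have -> : h = (fun u : R => u^-1) ^+ k * (fun u : R => expR (- u^-1)).
    by apply/funext => u; rewrite /h [RHS]/GRing.mul/= exprfctE.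
  apply: is_derive_eq (is_deriveM dX dE) _.
  rewrite /flat t0 /GRing.scale/= exprfctE.
  case: k dX h => [|k] _ _ /=; first by rewrite !expr0; ring.
  by rewrite !exprS; ring.
- have -> : - k%:R * flat k.+1 0 + flat k.+2 0 = flat k.+1 0.
    by rewrite /flat ltxx mulr0 addr0.
  (* At the origin the difference quotient of [flat k] is exactly [flat k.+1], already known to be
     continuous there. *)
  apply/is_derive1_caratheodory; exists (flat k.+1); split => //.
  + move=> z; rewrite {2}/flat ltxx !subr0 /flat.
    case: ifPn => [z0|]; last by rewrite mul0r.
    by rewrite exprS [z^-1 * _]mulrC -!mulrA [z^-1 * _]mulrCA mulVf ?gt_eqF// mulr1.
  + exact: flat_continuous0.
Unshelve. all: by end_near. Qed.

Lemma Cn_flat n k : Cn n (flat k).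
Proof.
elim: n k => // n IHn k; exists (fun t => - k%:R * flat k.+1 t + flat k.+2 t).
  exact: is_derive_flat.
by apply: CnD => //; apply: CnM => //; exact: Cn_cst.
Qed.

(** The classical smooth step. The two terms of the denominator never vanish together, and the
    transition is confined to [0, 1/2], so that [plateau] is 1 on [-1/2, 1/2] and 0 outside ]-1,
    1[. *)
Definition ramp (s : R) := flat 0 s / (flat 0 s + flat 0 (- s + 2^-1)).

Lemma flat_gt0 t : 0 < t -> 0 < flat 0 t.
Proof. by move=> t0; rewrite /flat t0 mulr_gt0 ?expR_gt0. Qed.

Lemma flat_le0 k t : t <= 0 -> flat k t = 0.
Proof. by rewrite leNgt /flat => /negbTE ->. Qed.

Lemma ramp_den_gt0 s : 0 < flat 0 s + flat 0 (- s + 2^-1).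
Proof.
have [s0|s0] := ltP 0 s; first by rewrite ltr_pwDl ?flat_gt0 ?flat_ge0.
by rewrite ltr_wpDl ?flat_ge0 ?flat_gt0//; lra.
Qed.

Lemma Cn_ramp n : Cn n ramp.
Proof.
apply: CnM; first exact: Cn_flat.
apply: CnV; first by move=> t; rewrite gt_eqF// ramp_den_gt0.
apply: CnD; first exact: Cn_flat.
under [X in Cn _ X]eq_fun do rewrite -mulN1r.
exact: (Cn_affine _ _ (Cn_flat n 0)).
Qed.

Lemma ramp_ge0 s : 0 <= ramp s.
Proof. by rewrite divr_ge0 ?flat_ge0// addr_ge0 ?flat_ge0. Qed.

Lemma ramp_le1 s : ramp s <= 1.
Proof. by rewrite ler_pdivrMr ?ramp_den_gt0// mul1r lerDl flat_ge0. Qed.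

Lemma ramp0 s : s <= 0 -> ramp s = 0.
Proof. by move=> s0; rewrite /ramp flat_le0 ?mul0r. Qed.

Lemma ramp1 s : 2^-1 <= s -> ramp s = 1.
Proof.
move=> s0; rewrite /ramp [flat 0 (_ + _)]flat_le0; last by lra.
by rewrite addr0 divff// gt_eqF// flat_gt0//; lra.
Qed.

Definition plateau (t : R) := ramp (1 * t + 1) * ramp (- 1 * t + 1).

Lemma Cn_plateau n : Cn n plateau.
Proof. by apply: CnM; apply: Cn_affine; exact: Cn_ramp. Qed.

Lemma plateau_ge0 t : 0 <= plateau t.
Proof. by rewrite mulr_ge0 ?ramp_ge0. Qed.

Lemma plateau_le1 t : plateau t <= 1.
Proof. by rewrite mulr_ile1 ?ramp_ge0 ?ramp_le1. Qed.

Lemma plateau1 t : `|t| <= 2^-1 -> plateau t = 1.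
Proof. by rewrite ler_norml => ?; rewrite /plateau !ramp1 ?mulr1//; lra. Qed.

Lemma plateau0 t : 1 <= `|t| -> plateau t = 0.
Proof.
rewrite ler_normr /plateau => /orP[t1|t1].
  by rewrite [X in _ * X]ramp0 ?mulr0//; lra.
by rewrite ramp0 ?mul0r//; lra.
Qed.

(** One-variable factor of the derivatives of a localized monomial: near 0 it is the n-th derivative
    of t^d, so it vanishes there if d < n and equals d! if d = n. *)
Definition bump d n : R -> R := derive1n n (fun t => t ^+ d * plateau t).

Lemma Cn_bump0 n d : Cn n (fun t : R => t ^+ d * plateau t).
Proof. by apply: CnM; [apply: CnX; exact: Cn_id|exact: Cn_plateau]. Qed.

Lemma is_derive_bump d n (t : R) : is_derive t (1 : R) (bump d n) (bump d n.+1 t).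
Proof. exact/Cn_derive1n/Cn_bump0. Qed.

Lemma continuous_bump d n : continuous (bump d n).
Proof.
move=> t; apply/differentiable_continuous/derivable1_diffP.
by case: (is_derive_bump d n t).
Qed.

Lemma derive1n_near_eq f g n (U : set R) : open U ->
  (forall t, U t -> f t = g t) -> forall t, U t -> derive1n n f t = derive1n n g t.
Proof.
move=> oU fg; elim: n => // n IHn t Ut.
rewrite !derive1nS !derive1E; apply: near_eq_derive.
have : nbhs t U by apply: open_nbhs_nbhs.
by apply: filterS => u; exact: IHn.
Qed.

Lemma derive1n_exp d n (t : R) :
  derive1n n (fun t : R => t ^+ d) t = (d ^_ n)%:R * t ^+ (d - n).
Proof.
elim: n t => [|n IHn] t; first by rewrite ffactn0 mul1r subn0.
pose c : R := (d ^_ n)%:R.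
rewrite derive1nS (_ : derive1n n _ = c \*: (id ^+ (d - n) : R -> R)); last first.
  by apply/funext => u; rewrite IHn exprfctE.
have dX := is_deriveX (d - n) (is_derive_id t (1 : R)).
rewrite derive1E; have [_ ->] := is_deriveZ c dX.
by rewrite ffactnSr natrM /GRing.scale/= mulr1 subnS mulrA.
Qed.

Lemma bump_near d n t : `|t| < 2^-1 -> bump d n t = (d ^_ n)%:R * t ^+ (d - n).
Proof.
move=> th; rewrite -derive1n_exp.
apply: (@derive1n_near_eq _ _ _ [set u : R | `|u| < 2^-1]) => //.
  rewrite (_ : mkset _ = ball (0 : R) 2^-1); first exact: ball_open.
  by apply/seteqP; split => u; rewrite /ball/= sub0r normrN.
by move=> u /= /ltW uh; rewrite plateau1 ?mulr1.
Qed.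

Lemma bump_far d n t : 1 < `|t| -> bump d n t = 0.
Proof.
move=> t1; rewrite /bump (@derive1n_near_eq _ (cst 0) _ [set u : R | 1 < `|u|])//.
- elim: n t {t1} => // n IHn t.
  by rewrite derive1nS (_ : derive1n n _ = cst 0) ?derive1_cst//; exact/funext.
- exact: (open_comp (fun u _ => @norm_continuous _ R^o u) (@open_gt R 1)).
- by move=> u /= /ltW u1; rewrite plateau0 ?mulr0.
Qed.

Lemma bump_bounded d n : exists2 M, 0 < M & forall t, `|bump d n t| <= M.
Proof.
have /compact_bounded[M0 [_ HM0]] : compact (bump d n @` `[-1, 1]).
  apply: continuous_compact; last exact: segment_compact.
  by apply: continuous_subspaceT; exact: continuous_bump.
exists (`|M0| + 1); first by rewrite ltr_wpDl.
move=> t; have [t1|/bump_far->] := leP `|t| 1; last by rewrite normr0 addr_ge0.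
apply: HM0; first by rewrite (le_lt_trans (ler_norm _))// ltrDl.
by exists t => //=; rewrite in_itv/= -ler_norml.
Qed.

End one_variable.

(** * Lebesgue measure on row vectors *)

Section measurable_row_vector.
Context {R : realType} {n : nat}.
Implicit Types (x y z : 'rV[R]_n) (f : 'rV[R]_n -> R).

Lemma coord_le_norm x i : `|x ord0 i| <= `|x|.
Proof.
rewrite [leRHS]/Num.Def.normr/= mx_normrE.
exact: (@le_bigmax _ _ _ 0 (fun ij : 'I_1 * 'I_n => `|x ij.1 ij.2|) (ord0, i)).
Qed.

Lemma norm_le_coord x (M : R) :
  0 <= M -> (forall i, `|x ord0 i| <= M) -> `|x| <= M.
Proof.
move=> M0 xM; rewrite [leLHS]/Num.Def.normr/= mx_normrE.
by apply/bigmax_leP; split => // -[i j] _ /=; rewrite ord1.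
Qed.

Lemma measurable_box (A : 'I_n -> set R) : (forall i, measurable (A i)) ->
  measurable [set v : 'rV[R]_n | forall i, A i (v ord0 i)].
Proof.
move=> mA; rewrite (_ : mkset _ =
    \bigcap_(i in [set: 'I_n]) ((fun v : 'rV[R]_n => v ord0 i) @^-1` A i)).
  apply: fin_bigcap_measurable => // i _.
  by rewrite -[X in measurable X]setTI; exact: measurable_coord.
by apply/seteqP; split => [v Av i _|v Av i]; exact: Av.
Qed.

(** The sigma-algebra is generated by the coordinates, not by the open sets. An open set is the
    union of the boxes with rational centre and radius that it contains, and these are countably
    many. *)
Lemma open_measurable_rV (U : set 'rV[R]_n) : open U -> measurable U.
Proof.
move=> oU.
pose box (p : 'rV[rat]_n * rat) := [set v : 'rV[R]_n |
  forall i, (`](ratr (p.1 ord0 i) - ratr p.2), (ratr (p.1 ord0 i) + ratr p.2)[%classic : set R) (v ord0 i)].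
rewrite (_ : U = \bigcup_p (if `[< box p `<=` U >] then box p else set0)).
  apply: countable_bigcupT_measurable => [|p].
    exact: countableP.
  by case: ifPn => // _; apply: (measurable_box (A := fun i =>
    `](ratr (p.1 ord0 i) - ratr p.2), (ratr (p.1 ord0 i) + ratr p.2)[%classic)).
apply/seteqP; split => [x Ux|x [p _]]; last first.
  by case: ifPn => // /asboolP; exact.
have /nbhs_ballP[e e0 xeU] : nbhs x U by apply: open_nbhs_nbhs.
have [r /[!in_itv]/= /andP[r0 re]] : exists q : rat, ratr q \in `]0, (e / 2)[%R.
  by apply: rat_in_itvoo; rewrite divr_gt0.
have /choice[q xq] : forall i, exists q : rat,
    ratr q \in `](x ord0 i - ratr r), (x ord0 i + ratr r)[%R.
  by move=> i; apply: rat_in_itvoo; rewrite ltrD2l gt0_cp.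
exists (\row_i q i, r) => //; rewrite ifT /box /=.
  by move=> i; move: (xq i); rewrite mxE !in_itv/=; lra.
apply/asboolP => v vp; apply: xeU.
rewrite -ball_normE /= (@le_lt_trans _ _ (2 * ratr r))//; last lra.
apply: norm_le_coord => [|i]; first lra.
move: (xq i) (vp i); rewrite !mxE !in_itv/= ler_norml; lra.
Qed.

Lemma continuous_measurable_rV f : continuous f -> measurable_fun [set: 'rV[R]_n] f.
Proof.
move=> cf; apply: (measurability _ (RGenOInfty.measurableE R)).
move=> _ [_ [a ->] <-]; rewrite setTI; apply: open_measurable_rV.
by apply: open_comp => [x _|]; [exact: cf|exact: interval_open].
Qed.

Lemma measurable_norm_rV : measurable_fun [set: 'rV[R]_n] (fun x => `|x| : R).
Proof. by apply: continuous_measurable_rV => x; exact: norm_continuous. Qed.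

Lemma continuous_enorm : continuous (@enorm R n).
Proof.
move=> x; apply: continuous_comp; last exact: sqrt_continuous.
apply: (@continuous_big _ _ +%R) => [|i _ y]; first exact: add_continuous.
apply: (continuous_comp (g := fun t : R => t ^+ 2)); last exact: exprn_continuous.
exact: coord_continuous.
Qed.

Lemma measurable_enorm : measurable_fun [set: 'rV[R]_n] (@enorm R n).
Proof. by apply: continuous_measurable_rV; exact: continuous_enorm. Qed.

Lemma measurable_subr_rV d (T : measurableType d) (F G : T -> 'rV[R]_n) :
  measurable_fun [set: T] F -> measurable_fun [set: T] G ->
  measurable_fun [set: T] (fun t => F t - G t : 'rV[R]_n).
Proof.
move=> mf mg; apply: measurable_fun_coordP => i.
under eq_fun do rewrite !mxE.
apply: measurable_funB; apply: (measurableT_comp (measurable_coord i)) => //.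
Qed.

Lemma lebesgue_ball_le z (t : R) : (0 < n)%N -> 0 <= t ->
  lebesgue_rV [set x : 'rV[R]_n | `|x - z| <= t] = ((2 * t) ^+ n)%:E.
Proof.
move=> n0 t0; rewrite (_ : mkset _ = [set v : 'rV[R]_n |
    forall i, (`[(z ord0 i - t), (z ord0 i + t)]%classic : set R) (v ord0 i)]).
  rewrite (lebesgue_rV_box (A := fun i => `[(z ord0 i - t), (z ord0 i + t)]%classic)).
    rewrite (eq_bigr (fun=> (2 * t)%:E)) => [|i _].
      by rewrite -[in RHS](card_ord n) -prodr_const -prodEFin.
    rewrite lebesgue_measure_itv/= lte_fin; case: ifPn => [_|].
      by rewrite -EFinD; congr EFin; ring.
    by rewrite -leNgt => h; congr EFin; lra.
  by move=> i; exact: measurable_itv.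
apply/seteqP; split => v /=.
  move=> vt i; have := le_trans (coord_le_norm _ i) vt.
  by rewrite !mxE ler_norml in_itv/=; lra.
move=> vt; apply: norm_le_coord => // i.
by move: (vt i); rewrite !mxE ler_norml in_itv/=; lra.
Qed.

End measurable_row_vector.

(** A single statement for both signs of the exponent: when [a < 0] the inverses are compared and
    the two bounds on [s] exchange their roles. *)
Lemma powR_le_ratio (R : realType) (k s t a : R) : 1 <= k -> 0 < s -> 0 < t ->
  t / k <= s -> s <= k * t -> s `^ a <= k `^ `|a| * t `^ a.
Proof.
move=> k1 s0 t0 ts st; have k0 : 0 < k by lra.
have [k0' s0' t0'] := And3 (ltW k0) (ltW s0) (ltW t0).
have homo b (x y : R) : 0 <= b -> 0 <= x -> x <= y -> x `^ b <= y `^ b.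
  by move=> b0 x0 xy; apply: ge0_ler_powR; rewrite ?nnegrE// (le_trans x0).
have [a0|a0] := leP 0 a; first by rewrite ger0_norm// -powRM// homo.
rewrite ltr0_norm// -[a in s `^ a]opprK -[a in t `^ a]opprK !(powRN _ (- a)).
rewrite ler_pdivlMr ?powR_gt0// ler_pdivrMl ?powR_gt0// -powRM//.
by apply: homo => //; [lra|rewrite -ler_pdivrMr].
Qed.

(** * Integrals of powers of a distance, by dyadic shells *)

Section shells.
Local Open Scope ereal_scope.
Context d (T : measurableType d) (R : realType) (mu : {measure set T -> \bar R}).

(** The integral of a nonnegative function is a supremum over the simple functions below it, so
    monotonicity involves no measurability. This allows the Riesz potential to be dominated without
    establishing that it is measurable. *)
Lemma ge0_le_integralW (D : set T) (f g : T -> \bar R) :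
  (forall x, D x -> 0 <= f x) -> (forall x, D x -> f x <= g x) ->
  \int[mu]_(x in D) f x <= \int[mu]_(x in D) g x.
Proof.
move=> f0 fg; rewrite !ge0_integralE//; last first.
  by move=> x Dx; apply: le_trans (fg _ Dx); exact: f0.
apply: ereal_sup_le => _ [h hf <-]; exists h => // x.
by apply: le_trans (hf x) _; exact: lee_restrict.
Qed.

Context (rho : T -> R) (c D : R).
Hypotheses (mrho : measurable_fun setT rho) (rho0 : forall x, (0 <= rho x)%R).
Hypotheses (c0 : (0 <= c)%R)
  (mu_rho : forall t, (0 < t)%R -> mu [set x | rho x <= t]%R <= (c * t `^ D)%:E).

Let mpow a : measurable_fun [set: T] (fun x => (rho x `^ (- a))%:E).
Proof.
have m : measurable_fun [set: T] (fun x => rho x `^ (- a))%R.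
  exact: measurableT_comp (measurable_powR (- a)) mrho.
exact/measurable_EFinP.
Qed.

Let shell (t : R) := [set x | t / 2 <= rho x <= t]%R.

Let mshell t : measurable (shell t).
Proof.
rewrite (_ : shell t = rho @^-1` [set` `[(t / 2)%R, t]]).
  by rewrite -[X in measurable X]setTI; exact: mrho.
by apply/seteqP; split => x /=; rewrite in_itv.
Qed.

Lemma integral_shell a (t : R) : (0 < t)%R ->
  \int[mu]_(x in shell t) (rho x `^ (- a))%:E <= (c * 2 `^ `|a| * t `^ (D - a))%:E.
Proof.
move=> t0; apply: (@le_trans _ _ (\int[mu]_(x in shell t) (2 `^ `|a| * t `^ (- a))%:E)).
  apply: ge0_le_integralW => x; first by rewrite lee_fin powR_ge0.
  move=> /= /andP[tx xt]; rewrite lee_fin -normrN; apply: powR_le_ratio => //; lra.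
rewrite integral_cst//.
rewrite (_ : (c * _ * _)%R = ((2 `^ `|a| * t `^ (- a)) * (c * t `^ D))%R).
  rewrite [leRHS]EFinM; apply: lee_wpmul2l.
    by rewrite lee_fin mulr_ge0// powR_ge0.
  apply: le_trans (mu_rho t0); apply: le_measure; rewrite ?inE//.
    rewrite -[X in measurable X]setTI (_ : mkset _ = rho @^-1` [set` `]-oo, t]]).
      exact: mrho.
    by apply/seteqP; split => x /=; rewrite in_itv.
  by move=> x /= /andP[].
rewrite powRD; first by ring.
by rewrite (gt_eqF t0) implybT.
Qed.

(** The shell of outer radius r lam^j contributes at most a constant times r^(D - a) (lam^(D -
    a))^j, and the geometric series is summed. The ratio 1/2 serves for balls and the ratio 2 for
    their complements. The only input on [rho] is the growth of its sublevel sets, so the same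
    estimate applies to row vectors with [D = n] and to the Gamma integral with [D = 1]. *)
Lemma integral_shells a (lam r : R) (S : set T) : (0 < lam)%R ->
  (lam `^ (D - a) < 1)%R -> (0 < r)%R -> measurable S ->
  (forall x, S x -> exists j, shell (r * lam ^+ j) x) ->
  \int[mu]_(x in S) (rho x `^ (- a))%:E <=
    (c * 2 `^ `|a| / (1 - lam `^ (D - a)) * r `^ (D - a))%:E.
Proof.
move=> lam0 lam1 r0 mS Scov.
pose g : T -> \bar R := fun x => (rho x `^ (- a))%:E; pose A j := shell (r * lam ^+ j).
have g0 x : 0 <= g x by rewrite lee_fin powR_ge0.
have gA0 j x : 0 <= (g \_ (A j)) x by apply: erestrict_ge0.
rewrite integral_mkcond.
apply: (@le_trans _ _ (\int[mu]_x (\sum_(j <oo) (g \_ (A j)) x))).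
  apply: ge0_le_integralW => x _; first by apply: erestrict_ge0 => y _; exact: g0.
  rewrite patchE; case: ifPn => [/[!inE] /Scov[j Ajx]|_]; last exact: nneseries_ge0.
  apply: le_trans (nneseries_lim_ge j.+1 _) => //.
  rewrite big_mkord big_ord_recr/= patchE mem_set//.
  by apply: leeDr; exact: sume_ge0.
rewrite integral_nneseries//; last first.
  move=> j; have := (measurable_restrictT g (mshell (r * lam ^+ j))).1.
  by apply; exact: measurable_funTS (mpow a).
under eq_eseriesr do rewrite -integral_mkcond.
set K := (c * _)%R; set s := (lam `^ _)%R.
have s0 : (0 <= s)%R by exact: powR_ge0.
have K0 : (0 <= K)%R by rewrite mulr_ge0// powR_ge0.
have H j : \int[mu]_(x in A j) g x <= (K * r `^ (D - a) * s ^+ j)%:E.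
  apply: le_trans (integral_shell _ _) _; first by rewrite mulr_gt0// exprn_gt0.
  have [r0' lam0'] := conj (ltW r0) (ltW lam0).
  rewrite powRM ?exprn_ge0// -powR_mulrn// -powRrM [(j%:R * _)%R]mulrC powRrM.
  by rewrite powR_mulrn// lee_fin mulrA.
apply: lime_le; first by apply: is_cvg_nneseries => j _ _; exact: integral_ge0.
apply: nearW => m; apply: le_trans (lee_sum _ (fun j _ => H j)) _.
rewrite sumEFin lee_fin -mulr_sumr [leRHS]mulrAC ler_wpM2l ?mulr_ge0 ?powR_ge0//.
have s1' : (0 < 1 - s)%R by rewrite subr_gt0.
rewrite big_mkord -[leRHS]mul1r ler_pdivlMr// mulrC.
rewrite -[(1 - s)%R]opprB mulNr -subrX1 opprB gerBl.
exact: exprn_ge0.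
Qed.


Lemma integral_le_ball a (r : R) : (a < D)%R -> (0 < r)%R ->
  \int[mu]_(x in [set x | 0 < rho x <= r]%R) (rho x `^ (- a))%:E <=
  (c * 2 `^ `|a| / (1 - 2^-1 `^ (D - a)) * r `^ (D - a))%:E.
Proof.
move=> aD r0; apply: integral_shells => //.
- rewrite /powR gt_eqF// expR_lt1 pmulr_rlt0 ?subr_gt0// ln_lt0//.
  by rewrite invr_gt0 ltr0n invf_lt1// ltr1n.
- rewrite (_ : mkset _ = rho @^-1` [set` `]0%R, r]]).
    by rewrite -[X in measurable X]setTI; exact: mrho.
  by apply/seteqP; split => x /=; rewrite in_itv.
move=> x /= /andP[x0 xr].
have ex : exists j, (r / rho x <= 2 ^+ j.+1)%R.
  exists (Num.Def.archi_bound (r / rho x)); apply/ltW/upper_nthrootP => //.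
(* The exponent found gives the lower bound of the shell; its minimality gives the upper one, except
   for [j = 0], where the upper bound is [rho x <= r] itself. *)
case: (ex_minnP ex) => j jP jmin; exists j; rewrite /shell/=.
have p0 m : (0 < (2 : R) ^+ m)%R by rewrite exprn_gt0.
rewrite exprVn; apply/andP; split.
  rewrite -mulrA -invfM -exprSr ler_pdivrMr// mulrC -ler_pdivrMr//.
rewrite ler_pdivlMr// mulrC -ler_pdivlMr//.
case: j => [|j] in jP jmin *; first by rewrite expr0 ler_pdivlMr// mul1r.
by rewrite leNgt; apply/negP => /ltW /jmin; rewrite ltnn.
Qed.

(** A shell is indexed by its outer radius, so the covering of the complement of the ball of radius
    r starts with the shell of outer radius 2 r. *)
Lemma integral_ge_ball a (r : R) : (D < a)%R -> (0 < r)%R ->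
  \int[mu]_(x in [set x | r <= rho x]%R) (rho x `^ (- a))%:E <=
  (c * 2 `^ `|a| / (1 - 2 `^ (D - a)) * (2 * r) `^ (D - a))%:E.
Proof.
move=> aD r0; apply: integral_shells => //.
- by rewrite /powR gt_eqF// expR_lt1 nmulr_rlt0 ?subr_lt0// ln_gt0// ltr1n.
- by rewrite mulr_gt0.
- rewrite (_ : mkset _ = rho @^-1` [set` `[r, +oo[]).
    by rewrite -[X in measurable X]setTI; exact: mrho.
  by apply/seteqP; split => x /=; rewrite in_itv/= andbT.
move=> x /= rx.
have ex : exists j, (rho x / r <= 2 ^+ j.+1)%R.
  exists (Num.Def.archi_bound (rho x / r)); apply/ltW/upper_nthrootP => //.
case: (ex_minnP ex) => j jP jmin; exists j; rewrite /shell/=.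
have p0 m : (0 < (2 : R) ^+ m)%R by rewrite exprn_gt0.
rewrite (_ : (2 * r * 2 ^+ j / 2 = 2 ^+ j * r)%R); last by field.
rewrite (_ : (2 * r * 2 ^+ j = 2 ^+ j.+1 * r)%R); last by rewrite exprS; ring.
apply/andP; split; last by rewrite -ler_pdivrMr.
rewrite -ler_pdivlMr//.
case: j => [|j] in jP jmin *; first by rewrite expr0 ler_pdivlMr// mul1r.
by rewrite leNgt; apply/negP => /ltW /jmin; rewrite ltnn.
Qed.

End shells.

Lemma continuous_prodr (R : realType) (T : topologicalType) (I : Type) (r : seq I)
    (F : I -> T -> R) : (forall i, continuous (F i)) ->
  continuous (fun x => \prod_(i <- r) F i x).
Proof.
move=> cF; elim: r => [|i r IHr] x.
  by under eq_fun do rewrite big_nil; exact: cst_continuous.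
under eq_fun do rewrite big_cons.
by apply: cvgM; [exact: cF|exact: IHr].
Qed.

(** * Test functions *)

Section product_functions.
Context {R : realType} {n : nat} (F : 'I_n -> nat -> R -> R).
Hypothesis dF : forall i c (t : R), is_derive t (1 : R) (F i c) (F i c.+1 t).

(** [F i c] stands for the c-th derivative of the i-th factor, so [prodf c] is the mixed partial
    derivative with multiplicities [c], in whatever order it is taken. *)
Definition prodf (c : 'I_n -> nat) (x : 'rV[R]_n) := \prod_(i < n) F i (c i) (x ord0 i).

(** Along the j-th axis the other factors are constant, so the difference quotient is that of a
    multiple of a one-variable function. *)
Lemma is_derive_prodf c j (x : 'rV[R]_n) :
  is_derive x (delta_mx ord0 j : 'rV[R]_n) (prodf c)
    (prodf (fun i => (j == i) + c i)%N x).
Proof.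
pose P := \prod_(i < n | i != j) F i (c i) (x ord0 i).
have prodE (y : 'rV[R]_n) : (forall i, i != j -> y ord0 i = x ord0 i) ->
    prodf c y = P * F j (c j) (y ord0 j).
  move=> yx; rewrite /prodf (bigD1 j)//= mulrC; congr (_ * _).
  by apply: eq_bigr => i ij; rewrite yx.
have qE : (fun h : R => h^-1 *: ((prodf c \o shift x) (h *: (delta_mx ord0 j : 'rV[R]_n)) - prodf c x)) =
    (fun h : R => h^-1 *: (((P \*: F j (c j)) \o shift (x ord0 j)) (h *: (1 : R)) - (P \*: F j (c j)) (x ord0 j))).
  apply/funext => h /=; congr (_ *: (_ - _)); last exact: prodE.
  rewrite prodE => [|i ij]; first by rewrite !mxE !eqxx.
  by rewrite !mxE (negbTE ij) andbF mulr0 add0r.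
have [dZ vZ] := is_deriveZ P (dF j (c j) (x ord0 j)).
split; first by rewrite /derivable qE.
rewrite /derive qE -[LHS]/('D_1 (P \*: F j (c j)) (x ord0 j)) vZ.
rewrite /prodf (bigD1 j)//= eqxx mulrC; congr (_ * _).
by apply: eq_bigr => i; rewrite eq_sym => /negbTE ->.
Qed.

Lemma partials_prodf s :
  partials s (prodf (fun=> 0%N)) = prodf (fun i => count_mem i s).
Proof.
elim: s => //= j s IHs; apply/funext => x; rewrite IHs.
by have [_ ->] := is_derive_prodf (fun i => count_mem i s) j x.
Qed.

Lemma continuous_prodf c : continuous (prodf c).
Proof.
rewrite /prodf; apply: continuous_prodr => i x.
apply: continuous_comp; first exact: coord_continuous.
by apply/differentiable_continuous/derivable1_diffP; case: (dF i (c i) (x ord0 i)).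
Qed.

Lemma rsmooth_prodf : rsmooth (prodf (fun=> 0%N)).
Proof.
move=> s; rewrite partials_prodf; split; first exact: continuous_prodf.
by move=> i x; case: (is_derive_prodf (fun i => count_mem i s) i x).
Qed.

End product_functions.

Section test_function_facts.
Context {R : realType} {n : nat}.
Implicit Types (x y : 'rV[R]_n).

Lemma partials_cst0 (s : seq 'I_n) : partials s (fun=> 0 : R) = (fun=> 0).
Proof.
by elim: s => //= j s ->; apply/funext => x; exact: derive_cst.
Qed.

Lemma rsmooth_cst0 : rsmooth (fun _ : 'rV[R]_n => 0 : R).
Proof.
move=> s; rewrite partials_cst0; split; first exact: cst_continuous.
by move=> i x; exact: derivable_cst.
Qed.

Lemma rsmooth_continuous (g : 'rV[R]_n -> R) : rsmooth g -> continuous g.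
Proof. by move=> /(_ [::])[]. Qed.

Lemma count_directions m (g : multiindex n m) i :
  count_mem i (directions g) = val g i.
Proof.
rewrite /directions count_flatten -map_comp sumnE big_map.
rewrite big_enum/= (bigD1 i)//= count_nseq/= eqxx mul1n.
rewrite big1 ?addn0// => j ji.
by rewrite count_nseq /= (negbTE ji) mul0n.
Qed.

Lemma compact_ball_rV (r : R) : compact [set x : 'rV[R]_n | `|x| <= r].
Proof.
have [r0|r0] := leP 0 r; last first.
  rewrite (_ : mkset _ = set0); first exact: compact0.
  by apply/seteqP; split => // x /= /(le_trans (normr_ge0 _)); rewrite leNgt r0.
rewrite (_ : mkset _ = [set v : 'rV[R]_n | forall i, (`[- r, r]%classic : set R) (v ord0 i)]).
  by apply: (@rV_compact _ _ (fun=> `[- r, r]%classic)) => i; exact: segment_compact.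
apply/seteqP; split => v /= vr.
  by move=> i; rewrite in_itv/= -ler_norml (le_trans (coord_le_norm _ i)).
by apply: norm_le_coord => // i; have := vr i; rewrite in_itv/= -ler_norml.
Qed.

Lemma compact_supportP (W : nmodType) (g : 'rV[R]_n -> W) (r : R) :
  (forall x, r < `|x| -> g x = 0) -> compact_support g.
Proof.
move=> g0; rewrite /compact_support; have cB := @compact_ball_rV r.
have clC : closed (closure [set x | g x != 0]) by exact: closed_closure.
apply: (subclosed_compact clC cB).
have cl : closed [set x : 'rV[R]_n | `|x| <= r].
  apply: compact_closed; last exact: compact_ball_rV.
  exact: norm_hausdorff.
rewrite [X in _ `<=` X]((closure_id _).1 cl); apply: closure_subset => x /= gx.
by rewrite leNgt; apply/negP => /g0 /eqP; rewrite (negbTE gx).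
Qed.

Lemma compact_support_bounded (W : nmodType) (g : 'rV[R]_n -> W) :
  compact_support g -> exists2 r : R, 0 < r & forall x, r < `|x| -> g x = 0.
Proof.
move=> /compact_bounded[M [_ HM]]; exists (`|M| + 1); first by rewrite ltr_wpDl.
move=> x xM; apply/eqP/negPn/negP => gx.
have : `|x| <= `|M| + 1.
  by apply: HM; [rewrite (le_lt_trans (ler_norm _))// ltrDl|exact: subset_closure].
by rewrite leNgt xM.
Qed.

Lemma continuous_bounded (g : 'rV[R]_n -> R) (r : R) : continuous g ->
  (forall x, r < `|x| -> g x = 0) -> exists2 M, 0 < M & forall x, `|g x| <= M.
Proof.
move=> cg g0.
have /compact_bounded[M [_ HM]] : compact (g @` [set x : 'rV[R]_n | `|x| <= r]).
  by apply: continuous_compact; [exact: continuous_subspaceT|exact: compact_ball_rV].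
exists (`|M| + 1); first by rewrite ltr_wpDl.
move=> x; have [xr|/g0->] := leP `|x| r; last by rewrite normr0 addr_ge0.
apply: HM; first by rewrite (le_lt_trans (ler_norm _))// ltrDl.
by exists x.
Qed.

Lemma integrable_bounded_support (h : 'rV[R]_n -> R) (M r : R) : (0 < n)%N ->
  measurable_fun [set: 'rV[R]_n] h -> 0 <= r -> (forall x, `|h x| <= M) ->
  (forall x, r < `|x| -> h x = 0) -> (@lebesgue_rV R n).-integrable setT (EFin \o h).
Proof.
move=> n0 mh r0 hM h0; apply/integrableP; split; first exact/measurable_EFinP.
pose B := [set x : 'rV[R]_n | `|x| <= r].
have muB : lebesgue_rV B = ((2 * r) ^+ n)%:E.
  rewrite -(lebesgue_ball_le 0 n0 r0); congr (lebesgue_rV _).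
  by apply/seteqP; split => x; rewrite /B/= subr0.
have mB : measurable B.
  rewrite (_ : B = (fun x => `|x| : R) @^-1` `]-oo, r]%classic).
    by rewrite -[X in measurable X]setTI; exact: measurable_norm_rV.
  by apply/seteqP; split => x; rewrite /B/= in_itv.
apply: (@le_lt_trans _ _ (\int[lebesgue_rV (n := n)]_(x in B) M%:E)%E).
  rewrite [leRHS]integral_mkcond; apply: ge0_le_integralW => x _ //=.
  rewrite patchE; case: ifPn => [_|]; first by rewrite lee_fin.
  by rewrite notin_setE /B/= => /negP; rewrite -ltNge => /h0->; rewrite normr0.
by rewrite integral_cst// [X in (_ * X)%E](_ : _ = ((2 * r) ^+ n)%:E)// -EFinM ltry.
Qed.

End test_function_facts.

(** * Cutoffs and localized monomials at scale [rho] *)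

Section cutoff.
Context {R : realType} {n : nat}.
Implicit Types (x y : 'rV[R]_n).

Definition cutoff (rho : R) y : R := \prod_(i < n) plateau (y ord0 i / rho).

(** The derivative of multi-index [g] of the monomial y^d localized at scale [rho]. No power of
    [rho] appears since [d] and [g] both have length [m]. *)
Definition bumps m (d g : multiindex n m) (rho : R) y : R :=
  \prod_(i < n) bump (val d i) (val g i) (y ord0 i / rho).

(** The c-th derivative of t^d [plateau] (t / rho), for nonzero [rho]. *)
Definition scaled_bump d (rho : R) c t := rho ^+ d * rho^-1 ^+ c * bump d c (t / rho).

Lemma is_derive_scaled_bump d rho c (t : R) :
  is_derive t (1 : R) (scaled_bump d rho c) (scaled_bump d rho c.+1 t).
Proof.
have da : is_derive t (1 : R) (fun t : R => t / rho) rho^-1.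
  have := is_derive_affine rho^-1 0 t.
  by under eq_fun do rewrite addr0 mulrC.
have dc := @is_derive1_comp _ (bump d c) (fun t => t / rho) t _ _ (is_derive_bump d c (t / rho)) da.
have H := is_deriveZ (rho ^+ d * rho^-1 ^+ c) dc.
suff -> : scaled_bump d rho c.+1 t =
  (rho ^+ d * rho^-1 ^+ c) *: (bump d c.+1 (t / rho) / rho) by exact: H.
by rewrite /scaled_bump /GRing.scale/= exprS; ring.
Qed.

Lemma cutoff_ge0 rho y : 0 <= cutoff rho y.
Proof. by apply: prodr_ge0 => i _; exact: plateau_ge0. Qed.

Lemma cutoff_le1 rho y : cutoff rho y <= 1.
Proof.
by apply: prodr_ile1 => i _; rewrite plateau_ge0 plateau_le1.
Qed.

Lemma cutoff1 rho y : 0 < rho -> `|y| <= rho / 2 -> cutoff rho y = 1.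
Proof.
move=> r0 yr; rewrite /cutoff big1// => i _; apply: plateau1.
rewrite normrM normfV (gtr0_norm r0) ler_pdivrMr// mulrC.
exact: le_trans (coord_le_norm _ _) yr.
Qed.

Lemma far_coord (rho : R) y : 0 < rho -> rho < `|y| -> exists i, 1 < `|y ord0 i / rho|.
Proof.
move=> r0 ry; apply: contrapT => /forallNP nex.
move: ry; rewrite ltNge => /negP; apply; apply: norm_le_coord; first exact: ltW.
move=> i; have /negP := nex i; rewrite -leNgt normrM normfV (gtr0_norm r0).
by rewrite ler_pdivrMr// mul1r.
Qed.

Lemma cutoff0 rho y : 0 < rho -> rho < `|y| -> cutoff rho y = 0.
Proof.
move=> r0 /(far_coord r0)[i yi].
by rewrite /cutoff (bigD1 i)//= plateau0 ?mul0r// ltW.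
Qed.

Lemma bumps0 m (d g : multiindex n m) rho y : 0 < rho -> rho < `|y| -> bumps d g rho y = 0.
Proof.
move=> r0 /(far_coord r0)[i yi].
by rewrite /bumps (bigD1 i)//= bump_far ?mul0r.
Qed.

(** Otherwise [g] is at most [d] in every coordinate, and the equality of their sums forces
    [d = g]. *)
Lemma multiindex_neq m (d g : multiindex n m) : d != g ->
  exists i, (val d i < val g i)%N.
Proof.
move=> dg; apply: contrapT => /forallNP nex.
have le i : (val g i <= val d i)%N by rewrite leqNgt; apply/negP/nex.
suff : d = g by move/eqP: dg.
apply/val_inj/ffunP => i; apply/val_inj/eqP => /=; rewrite eqn_leq le andbT.
rewrite leqNgt; apply/negP => lt.
have /eqP dm := valP d; have /eqP gm := valP g.
suff : (\sum_(i < n) val g i < \sum_(i < n) val d i)%N by rewrite dm gm ltnn.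
rewrite (bigD1 i)//= [ltnRHS](bigD1 i)//= -addSn leq_add//.
exact: leq_sum.
Qed.

(** Near the origin the test function is the monomial y^d itself; its derivative of multi-index [g],
    of the same order, is d! when [g = d] and 0 otherwise. This is how testing isolates one
    coefficient of the operator. *)
Lemma bumps_near m (d g : multiindex n m) rho y : 0 < rho -> `|y| < rho / 2 ->
  bumps d g rho y = (d == g)%:R * \prod_(i < n) (val d i)`!%:R.
Proof.
move=> r0 yr.
have near i : `|y ord0 i / rho| < 2^-1.
  rewrite normrM normfV (gtr0_norm r0) ltr_pdivrMr// mulrC.
  exact: le_lt_trans (coord_le_norm _ _) yr.
rewrite /bumps; under eq_bigr do rewrite bump_near//.
have [->|/multiindex_neq[i di]] := eqVneq d g.
  rewrite mul1r; apply: eq_bigr => i _.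
  by rewrite ffactnn subnn expr0 mulr1.
by rewrite mul0r (bigD1 i)//= ffact_small// !mul0r.
Qed.

Lemma bumps_bounded m (d g : multiindex n m) :
  exists2 M, 0 < M & forall rho y, `|bumps d g rho y| <= M.
Proof.
have /choice[M HM] : forall i, exists M, 0 < M /\ forall t : R, `|bump (val d i) (val g i) t| <= M.
  by move=> i; have [M M0 HM] := @bump_bounded R (val d i) (val g i); exists M.
exists (\prod_i M i); first by apply: prodr_gt0 => i _; have [] := HM i.
move=> rho y; rewrite normr_prod; apply: ler_prod => i _.
by rewrite normr_ge0; have [_ ->] := HM i.
Qed.

Lemma continuous_bumps m (d g : multiindex n m) rho : continuous (bumps d g rho).
Proof.
rewrite /bumps; apply: continuous_prodr => i x.
apply: (continuous_comp (f := fun x : 'rV[R]_n => x ord0 i / rho)); last exact: continuous_bump.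
by apply: (cvgM (@coord_continuous R 1 n ord0 i x)); exact: cvg_cst.
Qed.

Lemma continuous_cutoff rho : continuous (cutoff rho).
Proof.
have -> : cutoff rho = (fun y => \prod_(i < n) bump 0 0 (y ord0 i / rho)).
  apply/funext => y; apply: eq_bigr => i _.
  by rewrite /bump derive1n0 expr0 mul1r.
apply: continuous_prodr => i x.
apply: (continuous_comp (f := fun x : 'rV[R]_n => x ord0 i / rho)); last exact: continuous_bump.
by apply: (cvgM (@coord_continuous R 1 n ord0 i x)); exact: cvg_cst.
Qed.

Definition bump_test m (d : multiindex n m) (rho : R) (y : 'rV[R]_n) : R[i] :=
  (prodf (fun i => scaled_bump (val d i) rho) (fun=> 0%N) y)%:C%C.

Lemma test_fun_real (F : 'I_n -> nat -> R -> R) (r : R) :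
  (forall i c (t : R), is_derive t (1 : R) (F i c) (F i c.+1 t)) ->
  (forall y, r < `|y| -> prodf F (fun=> 0%N) y = 0) ->
  test_fun (fun y => (prodf F (fun=> 0%N) y)%:C%C).
Proof.
move=> dF F0; split; first split.
- exact: rsmooth_prodf.
- exact: rsmooth_cst0.
- by apply: (@compact_supportP _ _ _ _ r) => x /F0->.
Qed.

Lemma bump_test_fun m (d : multiindex n m) rho : 0 < rho -> test_fun (bump_test d rho).
Proof.
move=> r0; apply: (@test_fun_real _ rho) => [i c t|y /(far_coord r0)[i yi]].
  exact: is_derive_scaled_bump.
by rewrite /prodf (bigD1 i)//= /scaled_bump bump_far// mulr0 mul0r.
Qed.

Lemma mpartial_bump_test m (d g : multiindex n m) rho y : 0 < rho ->
  mpartial g (bump_test d rho) y = (bumps d g rho y)%:C%C.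
Proof.
move=> r0; rewrite /mpartial /bump_test /=.
rewrite (partials_cst0 (directions g)).
rewrite (partials_prodf (fun i c t => is_derive_scaled_bump (val d i) rho c t)).
congr (_ +i* _)%C; rewrite /prodf /scaled_bump big_split big_split/=.
have gE : (\sum_(i < n) count_mem i (directions g) = m)%N.
  under eq_bigr do rewrite count_directions.
  by apply/eqP; exact: (valP g).
have dE : (\sum_(i < n) sval d i = m)%N by apply/eqP; exact: (valP d).
(* The powers of [rho] collect to rho^m rho^-m = 1; this scale invariance makes the later constants
   independent of [rho]. *)
rewrite -!expr_sum gE dE.
rewrite exprVn divff ?expf_neq0 ?gt_eqF// mul1r.
by apply: eq_bigr => i _; rewrite count_directions.
Qed.

End cutoff.

(** * Vector-valued integrals *)

Section complex_vectors.
Context {R : realType}.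
Implicit Types (a b : R[i]).

(** An equivalent of the modulus suited to integrals taken separately on real and imaginary parts;
    it is still subadditive and submultiplicative. *)
Definition cabs a : R := `|complex.Re a| + `|complex.Im a|.

Lemma cabs_ge0 a : 0 <= cabs a. Proof. exact: addr_ge0. Qed.

Lemma cabsD a b : cabs (a + b) <= cabs a + cabs b.
Proof.
case: a b => [a1 a2] [b1 b2]; rewrite /cabs/= addrACA.
by rewrite lerD// ler_normD.
Qed.

Lemma cabsM a b : cabs (a * b) <= cabs a * cabs b.
Proof.
case: a b => [a1 a2] [b1 b2]; rewrite /cabs/=.
have h1 := ler_normB (a1 * b1) (a2 * b2).
have h2 := ler_normD (a1 * b2) (a2 * b1).
rewrite !normrM in h1 h2.
by rewrite (le_trans (lerD h1 h2))//; lra.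
Qed.

Lemma cabs_sum (I : Type) (r : seq I) (P : pred I) (F : I -> R[i]) :
  cabs (\sum_(i <- r | P i) F i) <= \sum_(i <- r | P i) cabs (F i).
Proof.
apply: (big_ind2 (fun a (x : R) => cabs a <= x)) => //.
  by rewrite /cabs/= normr0 addr0.
by move=> a x b y ax bY; rewrite (le_trans (cabsD _ _))// lerD.
Qed.

Lemma ReZ (x : R) a : complex.Re (x%:C%C * a) = x * complex.Re a.
Proof. by case: a => a1 a2 /=; rewrite mul0r subr0. Qed.

Lemma ImZ (x : R) a : complex.Im (x%:C%C * a) = x * complex.Im a.
Proof. by case: a => a1 a2 /=; rewrite mul0r addr0. Qed.

Section vectors.
Context {k : nat}.
Implicit Types (z w : 'cV[R[i]]_k).

Definition l1norm z : R := \sum_(j < k) cabs (z j ord0).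

Lemma l1norm_ge0 z : 0 <= l1norm z.
Proof. by apply: sumr_ge0 => j _; exact: cabs_ge0. Qed.

Lemma l1normD z w : l1norm (z + w) <= l1norm z + l1norm w.
Proof.
by rewrite /l1norm -big_split/=; apply: ler_sum => j _; rewrite mxE cabsD.
Qed.

Lemma l1norm_sum (I : Type) (r : seq I) (P : pred I) (F : I -> 'cV[R[i]]_k) :
  l1norm (\sum_(i <- r | P i) F i) <= \sum_(i <- r | P i) l1norm (F i).
Proof.
apply: (big_ind2 (fun (a : 'cV[R[i]]_k) (x : R) => l1norm a <= x)) => //.
  by rewrite /l1norm big1// => j _; rewrite mxE /cabs/= normr0 addr0.
by move=> a x b y ax bY; rewrite (le_trans (l1normD _ _))// lerD.
Qed.

Lemma l1normZ (x : R) z : l1norm (x%:C%C *: z) = `|x| * l1norm z.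
Proof.
rewrite /l1norm mulr_sumr; apply: eq_bigr => j _.
by rewrite mxE /cabs ReZ ImZ !normrM mulrDr.
Qed.

Lemma cnorm_ge0 z : 0 <= cnorm z. Proof. exact: sqrtr_ge0. Qed.

Lemma cnormZ (x : R) z : cnorm (x%:C%C *: z) = `|x| * cnorm z.
Proof.
rewrite /cnorm -(sqrtr_sqr x) -sqrtrM ?sqr_ge0// mulr_sumr; congr Num.sqrt.
by apply: eq_bigr => j _; rewrite mxE ReZ ImZ !exprMn mulrDr.
Qed.

Lemma cnorm_le_l1norm z : cnorm z <= l1norm z.
Proof.
have sumsq (I : Type) (r : seq I) (f : I -> R) : (forall i, 0 <= f i) ->
    \sum_(i <- r) f i ^+ 2 <= (\sum_(i <- r) f i) ^+ 2.
  move=> f0; elim: r => [|i r IHr]; first by rewrite !big_nil expr0n.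
  rewrite !big_cons sqrrD; have s0 : 0 <= \sum_(j <- r) f j by apply: sumr_ge0.
  have := mulr_ge0 (f0 i) s0.
  by rewrite -mulr_natr; nra.
rewrite -[leRHS]ger0_norm ?l1norm_ge0// -sqrtr_sqr ler_sqrt ?sqr_ge0//.
apply: le_trans (sumsq _ _ _ (fun j => cabs_ge0 _)).
apply: ler_sum => j _; rewrite /cabs sqrrD !real_normK ?num_real//.
by have := mulr_ge0 (normr_ge0 (complex.Re (z j ord0))) (normr_ge0 (complex.Im (z j ord0))); lra.
Qed.

Lemma abs_Re_le_cnorm z j : `|complex.Re (z j ord0)| <= cnorm z.
Proof.
rewrite -sqrtr_sqr ler_sqrt; last by apply: sumr_ge0 => i _; rewrite addr_ge0 ?sqr_ge0.
rewrite (bigD1 j)//= -addrA lerDl addr_ge0 ?sqr_ge0// sumr_ge0// => i _.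
by rewrite addr_ge0 ?sqr_ge0.
Qed.

Lemma abs_Im_le_cnorm z j : `|complex.Im (z j ord0)| <= cnorm z.
Proof.
rewrite -sqrtr_sqr ler_sqrt; last by apply: sumr_ge0 => i _; rewrite addr_ge0 ?sqr_ge0.
rewrite (bigD1 j)//= [_ ^+ 2 + _ ^+ 2]addrC -addrA lerDl addr_ge0 ?sqr_ge0// sumr_ge0// => i _.
by rewrite addr_ge0 ?sqr_ge0.
Qed.

Lemma cnorm0 : cnorm (0 : 'cV[R[i]]_k) = 0.
Proof. by rewrite /cnorm big1 ?sqrtr0// => j _; rewrite mxE/= expr0n/= addr0. Qed.

End vectors.

Lemma l1norm_mulmx p k (M : 'M[R[i]]_(p, k)) :
  exists2 C, 0 <= C & forall z : 'cV[R[i]]_k, l1norm (M *m z) <= C * l1norm z.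
Proof.
exists (\sum_(i < p) \sum_(j < k) cabs (M i j)).
  by apply: sumr_ge0 => i _; apply: sumr_ge0 => j _; exact: cabs_ge0.
move=> z; rewrite mulr_suml; apply: ler_sum => i _; rewrite mxE.
rewrite (le_trans (cabs_sum _ _ _))// mulr_suml; apply: ler_sum => j _.
rewrite (le_trans (cabsM _ _))// ler_wpM2l ?cabs_ge0//.
by rewrite /l1norm (bigD1 j)//= lerDl sumr_ge0// => j' _; exact: cabs_ge0.
Qed.

End complex_vectors.

Section vector_integrals.
Context {R : realType} {n k : nat}.
Notation mu := (@lebesgue_rV R n).
Implicit Types (f : 'rV[R]_n -> 'cV[R[i]]_k) (h : 'rV[R]_n -> R).

Lemma continuous_cnorm f :
  (forall j, continuous (fun x => complex.Re (f x j ord0)) /\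
             continuous (fun x => complex.Im (f x j ord0))) ->
  continuous (fun x => cnorm (f x)).
Proof.
move=> cf x; apply: continuous_comp; last exact: sqrt_continuous.
apply: (@continuous_big _ _ +%R) => [|j _ y]; first exact: add_continuous.
have [cR cI] := cf j.
have sq (g : 'rV[R]_n -> R) : continuous g -> {for y, continuous (fun x => g x ^+ 2)}.
  move=> cg; apply: (continuous_comp (f := g) (g := fun t : R => t ^+ 2)).
    exact: cg.
  exact: exprn_continuous.
exact: (cvgD (sq _ cR) (sq _ cI)).
Qed.

Lemma abs_Rintegral_le h : measurable_fun [set: 'rV[R]_n] h ->
  ((`|\int[mu]_x h x|%R)%:E <= \int[mu]_x (`|h x|)%:E)%E.
Proof.
move=> mh; have mh' : measurable_fun setT (EFin \o h) by exact/measurable_EFinP.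
apply: le_trans (le_abse_integral mu measurableT mh').
rewrite /Rintegral -[X in fine X]/(\int[mu]_x (EFin \o h) x)%E.
by case: (\int[mu]_x (EFin \o h) x)%E => [r| |]//=; rewrite ?normr0 ?leey// lee_fin.
Qed.

(* Also valid when the right-hand side is infinite, so that no integrability
   has to be known beforehand. *)
Lemma l1norm_vintegral_le f h : measurable_fun [set: 'rV[R]_n] h ->
  (forall j, measurable_fun setT (fun x => complex.Re (f x j ord0)) /\
             measurable_fun setT (fun x => complex.Im (f x j ord0))) ->
  measurable_fun setT (fun x => cnorm (f x)) ->
  ((l1norm (vintegral (fun x => (h x)%:C%C *: f x)))%:E <=
   (2 * k.+1%:R)%:E * \int[mu]_x (`|h x| * cnorm (f x))%:E)%E.
Proof.
move=> mh mf mcf.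
set B := (\int[mu]_x (`|h x| * cnorm (f x))%:E)%E.
have B0 : (0 <= B)%E.
  by apply: integral_ge0 => x _; rewrite lee_fin mulr_ge0// cnorm_ge0.
have part (g : 'rV[R]_n -> R) : measurable_fun setT g ->
    (forall x, `|g x| <= cnorm (f x)) ->
    ((`|\int[mu]_x (h x * g x)|%R)%:E <= B)%E.
  move=> mg gf; apply: le_trans (abs_Rintegral_le _) _; first exact: measurable_funM.
  apply: ge0_le_integralW => x _; rewrite lee_fin//.
  by rewrite normrM ler_wpM2l.
have [Boo|Boo] := eqVneq B +oo%E; first by rewrite Boo gt0_muley ?leey// lte_fin.
have Bfin : B \is a fin_num by rewrite ge0_fin_numE// ltey.
rewrite -(fineK Bfin) -EFinM lee_fin.
apply: (@le_trans _ _ (\sum_(j < k) (2 * fine B))).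
  apply: ler_sum => j _; rewrite /cabs mxE /cintegral/=.
  have [mR mI] := mf j.
  have := part _ mR (fun x => abs_Re_le_cnorm _ j).
  have := part _ mI (fun x => abs_Im_le_cnorm _ j).
  rewrite -(fineK Bfin) !lee_fin => hI hR.
  under [X in `|X| + _]eq_Rintegral do rewrite mxE ReZ.
  under [X in _ + `|X|]eq_Rintegral do rewrite mxE ImZ.
  by lra.
rewrite sumr_const card_ord -[_ *+ k]mulr_natr mulrAC ler_wpM2r ?fine_ge0//.
by rewrite ler_wpM2l// ler_nat.
Qed.

Lemma vintegralD f (g : 'rV[R]_n -> 'cV[R[i]]_k) :
  (forall j, mu.-integrable setT (EFin \o (fun x => complex.Re (f x j ord0))) /\
             mu.-integrable setT (EFin \o (fun x => complex.Im (f x j ord0)))) ->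
  (forall j, mu.-integrable setT (EFin \o (fun x => complex.Re (g x j ord0))) /\
             mu.-integrable setT (EFin \o (fun x => complex.Im (g x j ord0)))) ->
  vintegral (fun x => f x + g x) = vintegral f + vintegral g :> 'cV[R[i]]_k.
Proof.
move=> If Ig; apply/colP => j; rewrite !mxE /cintegral.
have [IfR IfI] := If j; have [IgR IgI] := Ig j.
apply/eqP; rewrite eq_complex/=; apply/andP; split; apply/eqP.
  rewrite -RintegralD//; apply: eq_Rintegral => x _; rewrite mxE.
  by case: (f x j ord0) (g x j ord0) => [? ?] [? ?].
rewrite -RintegralD//; apply: eq_Rintegral => x _; rewrite mxE.
by case: (f x j ord0) (g x j ord0) => [? ?] [? ?].
Qed.

Lemma vintegralZ (a : R) f :
  (forall j, mu.-integrable setT (EFin \o (fun x => complex.Re (f x j ord0))) /\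
             mu.-integrable setT (EFin \o (fun x => complex.Im (f x j ord0)))) ->
  vintegral (fun x => a%:C%C *: f x) = a%:C%C *: vintegral f.
Proof.
move=> If; apply/colP => j; rewrite !mxE /cintegral.
have [IfR IfI] := If j.
apply/eqP; rewrite eq_complex ReZ ImZ/=; apply/andP; split; apply/eqP.
  by rewrite -RintegralZl//; apply: eq_Rintegral => x _; rewrite mxE ReZ.
by rewrite -RintegralZl//; apply: eq_Rintegral => x _; rewrite mxE ImZ.
Qed.

End vector_integrals.

(** * The Riesz kernel and its remainder *)

Section euclidean_norm.
Context {R : realType} {n : nat}.
Implicit Types (x y : 'rV[R]_n).

Lemma norm_le_enorm x : `|x| <= enorm x.
Proof.
apply: norm_le_coord => [|i]; first exact: sqrtr_ge0.
rewrite -sqrtr_sqr ler_sqrt; last by apply: sumr_ge0 => j _; exact: sqr_ge0.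
by rewrite (bigD1 i)//= lerDl sumr_ge0// => j _; exact: sqr_ge0.
Qed.

Lemma enorm_le_norm x : enorm x <= n%:R * `|x|.
Proof.
have h : enorm x <= \sum_(i < n) `|x ord0 i|.
  rewrite -[leRHS]ger0_norm ?sumr_ge0// -sqrtr_sqr ler_sqrt ?sqr_ge0//.
  elim: n x => [|m IHm] x; first by rewrite !big_ord0 expr0n.
  pose x' : 'rV[R]_m := \row_i x ord0 (lift ord0 i).
  have := IHm x'; under eq_bigr do rewrite mxE.
  under [X in _ <= X ^+ 2 -> _]eq_bigr do rewrite mxE.
  rewrite !big_ord_recl sqrrD -[`|x ord0 ord0| ^+ 2]normrX (ger0_norm (sqr_ge0 _)).
  have : 0 <= `|x ord0 ord0| * \sum_(i < m) `|x ord0 (lift ord0 i)|.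
    by rewrite mulr_ge0// sumr_ge0.
  by rewrite -mulr_natr; lra.
rewrite (_ : n%:R * _ = \sum_(i < n) `|x|); last by rewrite sumr_const card_ord mulr_natl.
apply: le_trans h _.
by apply: ler_sum => i _; exact: coord_le_norm.
Qed.

Lemma enorm0 : enorm (0 : 'rV[R]_n) = 0.
Proof. by rewrite /enorm big1 ?sqrtr0// => i _; rewrite mxE expr0n. Qed.

Lemma enorm_ge0 x : 0 <= enorm x. Proof. exact: sqrtr_ge0. Qed.

Lemma enorm_gt0 x : x != 0 -> 0 < enorm x.
Proof. by rewrite -normr_gt0 => /lt_le_trans; apply; exact: norm_le_enorm. Qed.

(** The difference of the squared norms is a sum of [n] terms y_i (y_i - 2 x_i), each at most 3 |y|
    |x|. Dividing by the sum of the Euclidean norms, which is at least [enorm x] and so at least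
    |x|, gives the bound. *)
Lemma enorm_sub_le x y : x != 0 -> `|y| <= `|x| ->
  `|enorm (x - y) - enorm x| <= 3 * n%:R * `|y|.
Proof.
move=> x0 yx; have t0 := enorm_gt0 x0; rewrite -(ler_pM2r t0).
have sqE z : enorm z ^+ 2 = \sum_(i < n) z ord0 i ^+ 2.
  by rewrite sqr_sqrtr// sumr_ge0// => i _; exact: sqr_ge0.
apply: (@le_trans _ _ `|enorm (x - y) ^+ 2 - enorm x ^+ 2|).
  rewrite subr_sqr normrM ler_wpM2l// ger0_norm ?addr_ge0 ?enorm_ge0//.
  by rewrite lerDr enorm_ge0.
apply: (@le_trans _ _ (3 * n%:R * `|y| * `|x|)); last first.
  by rewrite ler_wpM2l ?norm_le_enorm// !mulr_ge0.
rewrite !sqE -sumrB (le_trans (ler_norm_sum _ _ _))//.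
rewrite (_ : 3 * _ * _ * _ = \sum_(i < n) (3 * `|y| * `|x|)); last first.
  by rewrite sumr_const card_ord -[RHS]mulr_natl; ring.
apply: ler_sum => i _; rewrite !mxE.
have xi := coord_le_norm x i; have yi := coord_le_norm y i.
rewrite (_ : _ - _ = y ord0 i * (y ord0 i - 2 * x ord0 i)); last by ring.
rewrite normrM [3 * _]mulrC -mulrA; apply: ler_pM => //.
rewrite (le_trans (ler_normB _ _))// normrM ger0_norm//; lra.
Qed.

End euclidean_norm.

Section power_kernel.
Context {R : realType}.
Implicit Types (b u v s t : R).

Lemma powR_antitone b u v : 0 <= b -> 0 < u -> u <= v -> v `^ (- b) <= u `^ (- b).
Proof.
move=> b0 u0 uv; have v0 := lt_le_trans u0 uv.
rewrite !powRN lef_pV2 ?posrE ?powR_gt0//; apply: ge0_ler_powR => //.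
  by rewrite nnegrE ltW.
by rewrite nnegrE ltW.
Qed.

(** Convexity: the graph of u^-b lies above its tangent at [u]. With r = v / u this reads r^-b >= 1
    - b (r - 1), which follows from exp z >= 1 + z and ln r <= r - 1. *)
Lemma powR_tangent b u v : 0 < b -> 0 < u -> u <= v ->
  u `^ (- b) - v `^ (- b) <= b * (v - u) * u `^ (- b - 1).
Proof.
move=> b0 u0 uv; have v0 := lt_le_trans u0 uv.
have u1 : u `^ (- b - 1) = u `^ (- b) / u.
  rewrite powRB; last by rewrite (gt_eqF u0) implybT.
  by rewrite powRr1// ltW.
have vE : v `^ (- b) = u `^ (- b) * (v / u) `^ (- b).
  rewrite -powRM ?ltW// ?divr_gt0//; congr (_ `^ _).
  by rewrite mulrC divfK// gt_eqF.
have vu0 : 0 < v / u by rewrite divr_gt0.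
have h : 1 - b * (v / u - 1) <= (v / u) `^ (- b).
  rewrite /powR gt_eqF//; apply: le_trans (expR_ge1Dx _).
  rewrite mulNr lerD2l lerN2 ler_pM2l//.
  have := @le_ln1Dx R (v / u - 1); rewrite [1 + _]addrC subrK; apply.
  by rewrite ltrBDl addrN.
rewrite vE u1 -{1}[u `^ (- b)]mulr1 -mulrBr.
rewrite (_ : b * _ * _ = u `^ (- b) * (b * (v / u - 1))); last first.
  by field; rewrite gt_eqF.
by rewrite ler_wpM2l ?powR_ge0//; lra.
Qed.

(** The tangent bound is applied at the smaller of [s] and [t]; that point is at least t / 2, which
    costs the factor 2^(b + 1). *)
Lemma powR_sub_le b s t : 0 < b -> 0 < t -> t / 2 <= s ->
  `|s `^ (- b) - t `^ (- b)| <= b * 2 `^ (b + 1) * `|s - t| * t `^ (- b - 1).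
Proof.
move=> b0 t0 ts; have s0 : 0 < s by lra.
have two1 : 1 <= 2 `^ (b + 1) :> R.
  by rewrite -[leLHS](powRr0 2); apply: ler_powR; lra.
have [st|st] := leP t s.
  have h := powR_tangent b0 t0 st.
  rewrite distrC !ger0_norm ?subr_ge0//; last exact: powR_antitone (ltW b0) t0 st.
  apply: le_trans h _; rewrite ler_wpM2r ?powR_ge0// ler_wpM2r ?subr_ge0//.
  by rewrite ler_peMr// ltW.
have h := powR_tangent b0 s0 (ltW st).
have m := powR_antitone (ltW b0) s0 (ltW st).
have -> : `|s - t| = t - s by rewrite distrC gtr0_norm// subr_gt0.
rewrite ger0_norm ?subr_ge0//.
apply: le_trans h _.
have H : s `^ (- b - 1) <= 2 `^ `|- b - 1| * t `^ (- b - 1).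
  by apply: powR_le_ratio => //; lra.
move: H; rewrite (_ : `|- b - 1| = b + 1); last first.
  by rewrite -opprD normrN gtr0_norm//; lra.
move=> H; rewrite (_ : _ * t `^ _ = b * (t - s) * (2 `^ (b + 1) * t `^ (- b - 1))); last by ring.
by apply: ler_wpM2l => //; rewrite mulr_ge0//; lra.
Qed.

Section hkernel.
Context {n : nat}.
Hypothesis n0 : (0 < n)%N.
Implicit Types (x y : 'rV[R]_n).

(* Dominates what is left of the kernel [|x - y|^-b] at [x] once its value
   [|x|^-b] at the origin, localized by a cutoff, has been subtracted. *)
Definition hkernel b x y : R :=
  if `|x| <= 6 * n%:R * `|y| then `|x - y| `^ (- b) else `|y| * `|x| `^ (- b - 1).

(** The constant matches the threshold of [hkernel]: half of [radius x] is |x| / (6 n), so the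
    annulus controlling the localized mean lies in the first branch. Below that threshold 3 n |y|,
    the bound of [enorm_sub_le], is at most half of |x|. *)
Definition radius x : R := `|x| / (3 * n%:R).

Let n1 : 1 <= n%:R :> R. Proof. by rewrite ler1n. Qed.

Lemma hkernel_ge0 b x y : 0 <= hkernel b x y.
Proof. by rewrite /hkernel; case: ifP => _; rewrite ?mulr_ge0 ?powR_ge0. Qed.

(** On this annulus 3 |y| <= |x|, so |x - y| is within a factor 2 of |x|. This lets the mass over
    the annulus be absorbed by the kernel. *)
Lemma hkernel_annulus b x y : 0 < b -> x != 0 ->
  radius x / 2 <= `|y| -> `|y| <= radius x ->
  enorm x `^ (- b) <= 2 `^ b * hkernel b x y.
Proof.
move=> b0; rewrite -normr_gt0 => x0 yl yr.
have h1 : `|x| <= 6 * n%:R * `|y|.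
  move: yl; rewrite (_ : radius x / 2 = `|x| / (6 * n%:R)); last first.
    by rewrite /radius; field; rewrite pnatr_eq0 -lt0n.
  by rewrite ler_pdivrMr ?mulr_gt0 ?ltr0n// mulrC.
have h2 : 3 * `|y| <= `|x|.
  move: yr; rewrite /radius ler_pdivlMr ?mulr_gt0 ?ltr0n//.
  by apply: le_trans; rewrite mulrC ler_wpM2l// ler_peMr.
have h3 : `|x - y| <= `|x| + `|y| by exact: ler_normB.
have h4 : `|x| - `|y| <= `|x - y| by exact: lerB_dist.
rewrite /hkernel h1.
apply: (@le_trans _ _ (`|x| `^ (- b))).
  by apply: powR_antitone => //; [exact: ltW|exact: norm_le_enorm].
rewrite -[in 2 `^ b](ger0_norm (ltW b0)) -[`|b|]normrN.
by apply: powR_le_ratio => //; lra.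
Qed.

(** If |x| <= 6 n |y|, both terms are bounded separately, the second one being carried by |y| <=
    [radius x]. Otherwise the cutoff equals 1 and the difference of two powers yields the gain |y| /
    |x|. *)
Lemma kernel_sub_cutoff b x y : 0 < b -> x != 0 ->
  `|(enorm (x - y) `^ b)^-1 - enorm x `^ (- b) * cutoff (radius x) y| <=
  (1 + 2 `^ b + 3 * n%:R * b * 2 `^ (b + 1)) * hkernel b x y.
Proof.
move=> b0 x0; have x0' : 0 < `|x| by rewrite normr_gt0.
have r0 : 0 < radius x by rewrite divr_gt0// mulr_gt0// ltr0n.
have H0 := hkernel_ge0 b x y.
have p0 c : 0 <= 2 `^ c :> R by exact: powR_ge0.
have c0 : 0 <= 3 * n%:R * b * 2 `^ (b + 1) by rewrite !mulr_ge0// ltW.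
have r2 : radius x / 2 = `|x| / (6 * n%:R) by rewrite /radius; field; rewrite pnatr_eq0 -lt0n.
have [xy|xy] := leP `|x| (6 * n%:R * `|y|).
  have kH : (enorm (x - y) `^ b)^-1 <= hkernel b x y.
    rewrite {1}/hkernel xy -powRN.
    (* At y = x both sides are the same power of 0. *)
    have [->|xy0] := eqVneq (x - y) 0; first by rewrite enorm0 normr0.
    apply: powR_antitone; [exact: ltW|by rewrite normr_gt0|exact: norm_le_enorm].
  have aH : enorm x `^ (- b) * cutoff (radius x) y <= 2 `^ b * hkernel b x y.
    have [yr|/(cutoff0 r0)->] := leP `|y| (radius x); last by rewrite mulr0 mulr_ge0.
    apply: le_trans (hkernel_annulus b0 x0 _ yr); last first.
      by rewrite r2 ler_pdivrMr ?mulr_gt0 ?ltr0n// mulrC.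
    by rewrite ler_piMr ?powR_ge0 ?cutoff_le1.
  apply: le_trans (ler_normB _ _) _.
  rewrite !ger0_norm ?mulr_ge0 ?invr_ge0 ?powR_ge0 ?cutoff_ge0//.
  have := mulr_ge0 c0 H0; rewrite !mulrDl mul1r.
  by move: (3 * n%:R * b * 2 `^ (b + 1) * hkernel b x y) => c; lra.
have yx : `|y| < radius x / 2 by rewrite r2 ltr_pdivlMr ?mulr_gt0 ?ltr0n// mulrC.
have yx' : `|y| <= `|x|.
  apply: ltW; apply: le_lt_trans xy.
  by rewrite -[leLHS]mul1r ler_wpM2r// (le_trans n1)// ler_peMl// ler1n.
have t0 := enorm_gt0 x0.
rewrite cutoff1 ?mulr1//; last exact: ltW.
have dist := enorm_sub_le x0 yx'.
have d2 : 3 * n%:R * `|y| <= enorm x / 2.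
  by move: xy (norm_le_enorm x); rewrite -!mulrA; move: (n%:R * `|y|) => z; lra.
rewrite -powRN; apply: le_trans (powR_sub_le b0 t0 _) _.
  by have := ler_norm (enorm x - enorm (x - y)); rewrite distrC; lra.
have xe : enorm x `^ (- b - 1) <= `|x| `^ (- b - 1).
  rewrite -opprD; apply: powR_antitone => //; first lra.
  exact: norm_le_enorm.
have HE : hkernel b x y = `|y| * `|x| `^ (- b - 1) by rewrite /hkernel leNgt xy.
apply: (@le_trans _ _ (3 * n%:R * b * 2 `^ (b + 1) * hkernel b x y)); last first.
  rewrite ler_wpM2r//; move: (p0 b) c0; move: (3 * n%:R * b * 2 `^ (b + 1)) => c; lra.
rewrite HE (_ : 3 * _ * _ * _ * _ = (b * 2 `^ (b + 1) * (3 * n%:R * `|y|)) * `|x| `^ (- b - 1)); last by ring.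
apply: ler_pM; rewrite ?powR_ge0 ?mulr_ge0//; first exact: ltW.
by apply: ler_wpM2l => //; rewrite mulr_ge0// ltW.
Qed.

Lemma hkernel_origin b x : x != 0 -> hkernel b x 0 = 0.
Proof.
by rewrite -normr_gt0 => x0; rewrite /hkernel normr0 mulr0 leNgt x0 mul0r.
Qed.

End hkernel.
End power_kernel.

(** * Weighted Schur estimate *)

Section integral_bounds.
Local Open Scope ereal_scope.

(** The function is dominated by the sum of the majorants, each restricted to its piece;
    measurability is asked of the pieces and majorants, and the pieces may overlap. *)
Lemma integral_le_cover d (T : measurableType d) (R : realType)
    (mu : {measure set T -> \bar R}) (D : set T) (f : T -> \bar R) (m : nat)
    (S : 'I_m -> set T) (g : 'I_m -> T -> \bar R) :
  (forall x, D x -> 0 <= f x) ->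
  (forall i, measurable (S i)) -> (forall i, measurable_fun setT (g i)) ->
  (forall i x, 0 <= g i x) ->
  (forall x, D x -> exists2 i, S i x & f x <= g i x) ->
  \int[mu]_(x in D) f x <= \sum_(i < m) \int[mu]_(x in S i) g i x.
Proof.
move=> f0 mS mg g0 cov.
under eq_bigr do rewrite integral_mkcond.
have r0 i x : 0 <= (g i \_ (S i)) x by apply: erestrict_ge0.
rewrite -ge0_integral_sum//; last first.
  move=> i; apply: (measurable_restrictT (g i) (mS i)).1.
  exact: measurable_funTS.
rewrite integral_mkcond; apply: ge0_le_integralW => x _.
  exact: erestrict_ge0.
rewrite patchE; case: ifPn => [/[!inE] /cov[i Six fg]|_]; last exact: sume_ge0.
rewrite (bigD1 i)//= patchE mem_set//; apply: le_trans fg _.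
by apply: leeDl; exact: sume_ge0.
Qed.

Lemma integral_le_cover3 d (T : measurableType d) (R : realType)
    (mu : {measure set T -> \bar R}) (D S1 S2 S3 : set T) (f g1 g2 g3 : T -> \bar R) :
  (forall x, D x -> 0 <= f x) ->
  measurable S1 -> measurable S2 -> measurable S3 ->
  measurable_fun setT g1 -> measurable_fun setT g2 -> measurable_fun setT g3 ->
  (forall x, 0 <= g1 x) -> (forall x, 0 <= g2 x) -> (forall x, 0 <= g3 x) ->
  (forall x, D x -> [\/ f x <= g1 x /\ S1 x, f x <= g2 x /\ S2 x | f x <= g3 x /\ S3 x]) ->
  \int[mu]_(x in D) f x <= \int[mu]_(x in S1) g1 x +
    (\int[mu]_(x in S2) g2 x + \int[mu]_(x in S3) g3 x).
Proof.
move=> f0 mS1 mS2 mS3 mg1 mg2 mg3 g10 g20 g30 cov.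
pose S (i : 'I_3) := if i == ord0 then S1 else if i == lift ord0 ord0 then S2 else S3.
pose g (i : 'I_3) := if i == ord0 then g1 else if i == lift ord0 ord0 then g2 else g3.
have := @integral_le_cover _ _ _ mu D f 3 S g f0.
rewrite 3!big_ord_recl big_ord0 adde0; apply.
- by move=> i; rewrite /S; case: ifP => // _; case: ifP.
- by move=> i; rewrite /g; case: ifP => // _; case: ifP.
- by move=> i x; rewrite /g; case: ifP => // _; case: ifP.
- move=> x /cov[[h s]|[h s]|[h s]].
  + by exists ord0.
  + by exists (lift ord0 ord0).
  + by exists (lift ord0 (lift ord0 ord0)).
Qed.

Section weighted_schur.
Context d1 d2 (X : measurableType d1) (Y : measurableType d2) (R : realType).
Variables (mu : {sigma_finite_measure set X -> \bar R}).
Variables (nu : {sigma_finite_measure set Y -> \bar R}).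
Variables (H : X * Y -> R) (w : X -> R) (v F : Y -> R) (q C : R).
Hypotheses (mH : measurable_fun setT H) (mw : measurable_fun setT w).
Hypotheses (mv : measurable_fun setT v) (mF : measurable_fun setT F).
Hypotheses (H0 : forall z, (0 <= H z)%R) (w0 : forall x, (0 <= w x)%R).
Hypotheses (v0 : forall y, (0 <= v y)%R) (F0 : forall y, (0 <= F y)%R).
Hypotheses (q1 : (1 <= q)%R).
Hypothesis Hv0 : forall x y, v y = 0%R -> H (x, y) = 0%R.

Let M := \int[nu]_y (v y * F y)%:E.

Let mpow d (T : measurableType d) (f : T -> R) a :
  measurable_fun setT f -> measurable_fun setT (fun x => f x `^ a)%R.
Proof. by move=> mf; exact: measurableT_comp (measurable_powR a) mf. Qed.

Let mpair1 d (T : measurableType d) (f : X * Y -> T) x :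
  measurable_fun setT f -> measurable_fun setT (fun y => f (x, y)).
Proof. by move=> mf; exact: measurableT_comp mf (measurable_pair1 x). Qed.

(** With q' = q / (q - 1), Hoelder's inequality is applied to the splitting H F = (H v^(-1/q')
    F^(1/q)) (v^(1/q') F^(1/q')). For q = 1 the two sides coincide. *)
Lemma hoelder_weighted x :
  (\int[nu]_y (H (x, y) * F y)%:E) `^ q <=
  M `^ (q - 1) * \int[nu]_y (H (x, y) `^ q * v y `^ (1 - q) * F y)%:E.
Proof.
have M0 : 0 <= M by apply: integral_ge0 => y _; rewrite lee_fin mulr_ge0.
have I0 : 0 <= \int[nu]_y (H (x, y) * F y)%:E.
  by apply: integral_ge0 => y _; rewrite lee_fin mulr_ge0.
move: q1; rewrite le_eqVlt => /predU1P[<-|qgt1].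
  rewrite subrr poweRe0 mul1e poweRe1// le_eqVlt; apply/orP; left; apply/eqP.
  by apply: eq_integral => y _; rewrite powRr1// powRr0 mulr1.
have q0 : (0 < q)%R by lra.
pose q' := (q / (q - 1))%R.
have q'0 : (0 < q')%R by rewrite divr_gt0//; lra.
have q'E : (q'^-1 = (q - 1) / q)%R by rewrite /q' invf_div.
have qq' : (q^-1 + q'^-1 = 1)%R.
  by rewrite q'E -[X in (X + _)%R]mul1r -mulrDl addrC subrK divff// gt_eqF.
pose f y := (H (x, y) * v y `^ (- q'^-1) * F y `^ q^-1)%R.
pose g y := (v y `^ q'^-1 * F y `^ q'^-1)%R.
have mHx : measurable_fun setT (fun y => H (x, y)) by exact: mpair1.
have mf : measurable_fun setT f.
  by apply: measurable_funM; [apply: measurable_funM => //; exact: mpow|exact: mpow].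
have mg : measurable_fun setT g by apply: measurable_funM; exact: mpow.
have f0 y : (0 <= f y)%R by rewrite !mulr_ge0// powR_ge0.
have g0 y : (0 <= g y)%R by rewrite !mulr_ge0// powR_ge0.
have := hoelder nu mf mg q0 q'0 qq'.
have -> : 'N[nu]_1[EFin \o (f \* g)%R] = \int[nu]_y (H (x, y) * F y)%:E.
  rewrite Lnorm1; apply: eq_integral => y _ /=.
  suff fg : (f y * g y = H (x, y) * F y)%R by rewrite fg ger0_norm ?mulr_ge0.
  (* Where [v] vanishes its two powers do not cancel; there [Hv0] makes both sides 0. *)
  have [vy|vy] := eqVneq (v y) 0%R; first by rewrite /f Hv0// !mul0r.
  have vK : (v y `^ (- q'^-1) * v y `^ q'^-1 = 1)%R.
    by rewrite powRN mulVf// powR_eq0 (negbTE vy).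
  have FK : (F y `^ q^-1 * F y `^ q'^-1 = F y)%R.
    by rewrite -powRD ?qq' ?powRr1// oner_eq0.
  rewrite /f /g -[RHS]mulr1 -vK -[in RHS]FK; ring.
have -> : 'N[nu]_q%:E[EFin \o f] =
    (\int[nu]_y (H (x, y) `^ q * v y `^ (1 - q) * F y)%:E) `^ q^-1.
  rewrite unlock; congr (_ `^ _); apply: eq_integral => y _ /=.
  suff fq : (f y `^ q = H (x, y) `^ q * v y `^ (1 - q) * F y)%R by rewrite ger0_norm// fq.
  rewrite !powRM ?mulr_ge0 ?powR_ge0// -!powRrM mulVf ?gt_eqF// powRr1// q'E.
  by rewrite mulNr divfK ?gt_eqF// opprB.
have -> : 'N[nu]_q'%:E[EFin \o g] = M `^ q'^-1.
  rewrite unlock; congr (_ `^ _); apply: eq_integral => y _ /=.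
  suff gq : (g y `^ q' = v y * F y)%R by rewrite ger0_norm// gq.
  by rewrite powRM ?powR_ge0// -!powRrM mulVf ?gt_eqF// !powRr1.
set I := \int[nu]_y _; set J := \int[nu]_y _ => hold.
have J0 : 0 <= J.
  by apply: integral_ge0 => y _; rewrite lee_fin !mulr_ge0// powR_ge0.
apply: (@le_trans _ _ ((J `^ q^-1 * M `^ q'^-1) `^ q)).
  apply: (gt0_ler_poweR (ltW q0)) => //; rewrite in_itv/= leey andbT//.
  by rewrite mule_ge0// poweR_ge0.
rewrite poweRM ?poweR_ge0// -!poweRrM mulVf ?gt_eqF// poweRe1// muleC.
by rewrite q'E divfK// gt_eqF.
Qed.

(** Tonelli's theorem turns the column bound on H^q w into m^(q-1) times the integral of v^(1-q) F C
    v^q, that is C m^q. The conclusion provides a majorant [g] because its measurability, supplied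
    by Tonelli's theorem, is required for the comparison away from the origin. *)
Lemma schur_majorant (m : R) : M = m%:E -> (0 <= C)%R ->
  (forall y, \int[mu]_x (H (x, y) `^ q * w x)%:E <= (C * v y `^ q)%:E) ->
  exists2 g : X -> \bar R, measurable_fun setT g /\ (forall x, 0 <= g x) &
    (forall x, (\int[nu]_y (H (x, y) * F y)%:E) `^ q * (w x)%:E <= g x) /\
    \int[mu]_x g x <= (C * m `^ q)%:E.
Proof.
move=> Mm C0 HC.
have m0 : (0 <= m)%R.
  by rewrite -lee_fin -Mm; apply: integral_ge0 => y _; rewrite lee_fin mulr_ge0.
pose k z := (H z `^ q * v z.2 `^ (1 - q) * F z.2 * w z.1)%R.
have mk : measurable_fun setT k.
  apply: measurable_funM; last exact: measurableT_comp mw measurable_fst.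
  apply: measurable_funM; last exact: measurableT_comp mF measurable_snd.
  apply: measurable_funM; first exact: mpow.
  by apply: mpow; exact: measurableT_comp mv measurable_snd.
have k0 z : 0 <= (k z)%:E by rewrite lee_fin !mulr_ge0// powR_ge0.
have mkE : measurable_fun setT (EFin \o k) by exact/measurable_EFinP.
have mkF := measurable_fun_fubini_tonelli_F (m2 := nu) (EFin \o k) mkE k0.
exists (fun x => (m `^ (q - 1))%:E * \int[nu]_y (k (x, y))%:E).
  split; first by apply: emeasurable_funM => //; exact: measurable_cst.
  move=> x; rewrite mule_ge0// ?lee_fin ?powR_ge0//; exact: integral_ge0.
split.
  move=> x; apply: le_trans (lee_wpmul2r _ (hoelder_weighted x)) _.
    by rewrite lee_fin.
  rewrite Mm poweR_EFin -muleA le_eqVlt; apply/orP; left; apply/eqP; congr (_ * _).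
  rewrite muleC -ge0_integralZl_EFin//.
  - by apply: eq_integral => y _; rewrite -EFinM /k mulrC.
  - by move=> y _; rewrite lee_fin !mulr_ge0// powR_ge0.
  - apply/measurable_EFinP; apply: measurable_funM => //.
    by apply: measurable_funM; apply: mpow => //; exact: mpair1.
rewrite ge0_integralZl_EFin ?powR_ge0//; last by move=> x _; exact: integral_ge0.
rewrite (fubini_tonelli (EFin \o k))//=.
have mqE : (C * m `^ q = m `^ (q - 1) * (C * m))%R.
  by rewrite -(mulr_powRB1 m0 (lt_le_trans ltr01 q1)); ring.
rewrite mqE EFinM; apply: lee_wpmul2l; first by rewrite lee_fin powR_ge0.
rewrite EFinM -Mm -ge0_integralZl_EFin//; last 2 first.
- by move=> y _; rewrite lee_fin mulr_ge0.
- by apply/measurable_EFinP; exact: measurable_funM.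
apply: ge0_le_integralW => y _; first exact: integral_ge0.
have c0 : (0 <= v y `^ (1 - q) * F y)%R by rewrite mulr_ge0// powR_ge0.
have -> : \int[mu]_x (k (x, y))%:E =
    (v y `^ (1 - q) * F y)%:E * \int[mu]_x (H (x, y) `^ q * w x)%:E.
  rewrite -ge0_integralZl_EFin//.
  - by apply: eq_integral => x _; rewrite -EFinM /k/=; congr (_)%:E; ring.
  - by move=> x _; rewrite lee_fin mulr_ge0// powR_ge0.
  - apply/measurable_EFinP; apply: measurable_funM => //; apply: mpow.
    exact: measurableT_comp mH (measurable_pair2 y).
apply: le_trans (lee_wpmul2l _ (HC y)) _; first by rewrite lee_fin.
rewrite -!EFinM lee_fin.
rewrite (_ : _ * _ * _ = C * ((v y `^ q * v y `^ (1 - q)) * F y))%R; last by ring.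
rewrite ler_wpM2l// ler_wpM2r//.
have [->|vy] := eqVneq (v y) 0%R.
  by rewrite powR0 ?mul0r// gt_eqF// (lt_le_trans ltr01).
by rewrite -powRD ?vy ?implybT// addrCA subrr addr0 powRr1.
Qed.

End weighted_schur.
End integral_bounds.

(** * Column integrals of the remainder kernel *)

Section hkernel_integral.
Context {R : realType} {n : nat}.
Hypothesis n0 : (0 < n)%N.
Notation mu := (@lebesgue_rV R n).

(* Set to [0] at [x = 0], a null set, so that the vanishing of the weight
   [|y|^alpha] at [y = 0] is compensated. *)
Definition hkernel0 b (z : 'rV[R]_n * 'rV[R]_n) : R :=
  if z.1 == 0 then 0 else hkernel b z.1 z.2.

Lemma hkernel0_ge0 b z : 0 <= hkernel0 b z.
Proof. by rewrite /hkernel0; case: ifP => // _; exact: hkernel_ge0. Qed.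

Lemma measurable_hkernel0 b : measurable_fun setT (hkernel0 b).
Proof.
have m1 : measurable_fun setT (fun z : 'rV[R]_n * 'rV[R]_n => `|z.1| : R).
  exact: measurableT_comp measurable_norm_rV measurable_fst.
have m2 : measurable_fun setT (fun z : 'rV[R]_n * 'rV[R]_n => `|z.2| : R).
  exact: measurableT_comp measurable_norm_rV measurable_snd.
have m3 : measurable_fun setT (fun z : 'rV[R]_n * 'rV[R]_n => `|z.1 - z.2| : R).
  apply: measurableT_comp measurable_norm_rV _.
  by apply: measurable_subr_rV; [exact: measurable_fst|exact: measurable_snd].
rewrite (_ : hkernel0 b = fun z => if `|z.1| == 0 then 0 else
    if `|z.1| <= 6 * n%:R * `|z.2| then `|z.1 - z.2| `^ (- b)
    else `|z.2| * `|z.1| `^ (- b - 1)); last first.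
  by apply/funext => z; rewrite /hkernel0 normr_eq0.
apply: measurable_fun_ifT.
- by apply: measurable_fun_eqr => //; exact: measurable_cst.
- exact: measurable_cst.
apply: measurable_fun_ifT.
- apply: measurable_fun_ler => //; apply: measurable_funM => //.
- exact: measurableT_comp (measurable_powR _) m3.
- apply: measurable_funM => //.
  exact: measurableT_comp (measurable_powR _) m1.
Qed.

Let mnorm z : measurable_fun setT (fun x : 'rV[R]_n => `|x - z| : R).
Proof.
apply: measurableT_comp measurable_norm_rV _.
by apply: measurable_subr_rV; [exact: measurable_id|exact: measurable_cst].
Qed.

Let mu_ball z (t : R) : 0 < t ->
  (mu [set x : 'rV[R]_n | `|x - z| <= t]%R <= (2 ^+ n * t `^ n%:R)%:E)%E.
Proof.
move=> t0; rewrite le_eqVlt; apply/orP; left; apply/eqP.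
apply: (etrans (lebesgue_ball_le z n0 (ltW t0))); congr (_%:E).
by rewrite exprMn powR_mulrn// ltW.
Qed.

Let mball z (r : R) : measurable [set x : 'rV[R]_n | 0 < `|x - z| <= r].
Proof.
have -> : [set x : 'rV[R]_n | 0 < `|x - z| <= r] =
    (fun x => `|x - z|) @^-1` [set` `]0%R, r]].
  by apply/seteqP; split => x /=; rewrite in_itv.
by rewrite -[X in measurable X]setTI; exact: mnorm.
Qed.

Let mext z (r : R) : measurable [set x : 'rV[R]_n | r <= `|x - z|].
Proof.
have -> : [set x : 'rV[R]_n | r <= `|x - z|] =
    (fun x => `|x - z|) @^-1` [set` `[r, +oo[].
  by apply/seteqP; split => x /=; rewrite in_itv/= andbT.
by rewrite -[X in measurable X]setTI; exact: mnorm.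
Qed.

Let ball_bound z (a r A : R) : 0 <= A -> a < n%:R -> 0 < r ->
  (\int[mu]_(x in [set x | 0%R < `|x - z| <= r]%R) (A * `|x - z| `^ (- a))%:E <=
   (A * (2 ^+ n * 2 `^ `|a| / (1 - 2^-1 `^ (n%:R - a)) * r `^ (n%:R - a)))%:E)%E.
Proof.
move=> A0 an r0; under eq_integral do rewrite EFinM.
rewrite ge0_integralZl_EFin//.
- rewrite EFinM; apply: lee_wpmul2l => //.
  by apply: integral_le_ball => //; solve [exact: mnorm | exact: mu_ball].
apply: measurable_funTS; apply/measurable_EFinP.
  exact: measurableT_comp (measurable_powR _) (mnorm z).
Qed.

Let ext_bound z (a r A : R) : 0 <= A -> n%:R < a -> 0 < r ->
  (\int[mu]_(x in [set x | r <= `|x - z|]%R) (A * `|x - z| `^ (- a))%:E <=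
   (A * (2 ^+ n * 2 `^ `|a| / (1 - 2 `^ (n%:R - a)) * (2 * r) `^ (n%:R - a)))%:E)%E.
Proof.
move=> A0 an r0; under eq_integral do rewrite EFinM.
rewrite ge0_integralZl_EFin//.
- rewrite EFinM; apply: lee_wpmul2l => //.
  by apply: integral_ge_ball => //; solve [exact: mnorm | exact: mu_ball].
apply: measurable_funTS; apply/measurable_EFinP.
  exact: measurableT_comp (measurable_powR _) (mnorm z).
Qed.

(** Three regions: |x| at most a multiple of |y| and away from y, where |x - y| is comparable to
    |y|; x close to y, where |x| is comparable to |y|; |x| large, where the second branch of the
    kernel applies. In each one a single power of |x| or |x - y| is left to integrate. *)
Lemma hkernel0_pointwise (b q c : R) (x y : 'rV[R]_n) : 0 < b -> 0 < q -> y != 0 -> x != 0 ->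
  hkernel b x y `^ q * `|x| `^ (- c) <=
  (6 * n%:R + 1) `^ (b * q) * `|y| `^ (- (b * q)) * `|x| `^ (- c) /\ `|x| <= 6 * n%:R * `|y| \/
  hkernel b x y `^ q * `|x| `^ (- c) <=
    2 `^ `|c| * `|y| `^ (- c) * `|x - y| `^ (- (b * q)) /\ 0 < `|x - y| <= `|y| / 2 \/
  hkernel b x y `^ q * `|x| `^ (- c) <=
    `|y| `^ q * `|x| `^ (- ((b + 1) * q + c)) /\ 6 * n%:R * `|y| <= `|x|.
Proof.
move=> b0 q0; rewrite -!normr_gt0 => y0 x0.
have bq0 : 0 < b * q by rewrite mulr_gt0.
have K6 : 6 <= 6 * n%:R :> R by rewrite ler_peMr// ler1n.
move: K6; rewrite /hkernel; move: (6 * n%:R) => K K6.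
have [xK|Kx] := leP `|x| (K * `|y|); last first.
  right; right; split; last exact: ltW.
  rewrite powRM ?powR_ge0// -powRrM -mulrA -powRD; last by rewrite (gt_eqF x0) implybT.
  by rewrite le_eqVlt; apply/orP; left; apply/eqP; congr (_ * _ `^ _); ring.
rewrite -powRrM mulNr.
(* The point x = y goes to the first region: a nonzero power of 0 is 0, so the left-hand side
   vanishes. *)
have [xy0|xy0] := eqVneq `|x - y| 0.
  left; split => //; rewrite xy0 powR0 ?oppr_eq0 ?gt_eqF// mul0r.
  by rewrite !mulr_ge0// powR_ge0.
have xy0' : 0 < `|x - y| by rewrite lt_def xy0 normr_ge0.
have h1 : `|x - y| <= `|x| + `|y| by exact: ler_normB.
have h2 : `|y| - `|x - y| <= `|x|.
  by rewrite lerBlDr; have := ler_normB x (x - y); rewrite subKr.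
have h3 : `|x| <= `|y| + `|x - y|.
  by rewrite -[x in leLHS](subrK y) addrC (le_trans (ler_normD _ _))// addrC.
have [small|big] := leP `|x - y| (`|y| / 2).
  right; left; split; last by rewrite xy0'.
  rewrite mulrC; apply: ler_wpM2r; first exact: powR_ge0.
  rewrite -[`|c|]normrN; apply: powR_le_ratio => //; lra.
left; split => //; apply: ler_wpM2r; first exact: powR_ge0.
rewrite -[in (K + 1) `^ _](gtr0_norm bq0) -[`|b * q|]normrN.
apply: powR_le_ratio => //; [lra| |].
  rewrite ler_pdivrMr; last lra.
  have : `|x - y| * 2 <= `|x - y| * (K + 1) by apply: ler_wpM2l => //; lra.
  lra.
by rewrite mulrDl mul1r; lra.
Qed.

(** Each region yields a power of |y|, and n = q (b + alpha + beta) makes all three exponents equal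
    to alpha q. *)
Lemma hkernel0_integral (b q alpha beta : R) : 0 < b -> 0 < q ->
  b * q < n%:R -> beta * q < n%:R -> alpha < 1 ->
  n%:R = q * (b + alpha + beta) ->
  exists2 C, 0 <= C & forall y : 'rV[R]_n,
    (\int[mu]_x (hkernel0 b (x, y) `^ q * `|x| `^ (- (beta * q)))%:E <=
     (C * (`|y| `^ alpha) `^ q)%:E)%E.
Proof.
move=> b0 q0 bq bbq a1 nq.
set c := beta * q; set K : R := 6 * n%:R.
have K0 : 0 < K by rewrite mulr_gt0// ltr0n.
set a3 := (b + 1) * q + c.
(* Integrability at infinity is exactly the condition alpha < 1. *)
have a3n : n%:R < a3.
  rewrite nq /a3 /c (_ : _ + _ = q * (b + 1 + beta)); last by ring.
  by rewrite ltr_pM2l//; lra.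
pose C1 := (K + 1) `^ (b * q) * (2 ^+ n * 2 `^ `|c| / (1 - 2^-1 `^ (n%:R - c)) * K `^ (n%:R - c)).
pose C2 := 2 `^ `|c| * (2 ^+ n * 2 `^ `|b * q| / (1 - 2^-1 `^ (n%:R - b * q)) *
  2^-1 `^ (n%:R - b * q)).
pose C3 := 2 ^+ n * 2 `^ `|a3| / (1 - 2 `^ (n%:R - a3)) * (2 * K) `^ (n%:R - a3).
(* Absolute values avoid discussing the signs of the denominators of the geometric series. *)
exists (`|C1| + `|C2| + `|C3|); first by rewrite !addr_ge0.
move=> y; have [->|y0] := eqVneq y 0.
  rewrite integral0_eq ?lee_fin ?mulr_ge0 ?addr_ge0 ?powR_ge0// => x _.
  rewrite /hkernel0/=; case: eqVneq => [_|x0]; last rewrite hkernel_origin//.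
    by rewrite powR0 ?mul0r// gt_eqF.
  by rewrite powR0 ?mul0r// gt_eqF.
have r0 : 0 < `|y| by rewrite normr_gt0.
pose r := `|y|; rewrite -powRrM.
rewrite (_ : (fun x => _) = (fun x => (hkernel b x y `^ q * `|x| `^ (- c))%:E) \_ [set x | x != 0]); last first.
  apply/funext => x; rewrite patchE /hkernel0/=; case: ifPn => [/eqP->|x0].
    by rewrite ifF ?powR0 ?mul0r ?gt_eqF//; apply/negbTE; rewrite notin_setE/= eqxx.
  by rewrite mem_set.
rewrite -integral_mkcond.
have mp z A a : measurable_fun setT (fun x : 'rV[R]_n => (A * `|x - z| `^ a)%:E).
  apply/measurable_EFinP; apply: measurable_funM => //.
  exact: measurableT_comp (measurable_powR _) (mnorm z).
have p0 z A a (x : 'rV[R]_n) : 0 <= A -> (0 <= (A * `|x - z| `^ a)%:E)%E.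
  by move=> A0; rewrite lee_fin mulr_ge0// powR_ge0.
pose A1 := (K + 1) `^ (b * q) * r `^ (- (b * q)).
pose A2 := 2 `^ `|c| * r `^ (- c).
have A10 : 0 <= A1 by rewrite mulr_ge0// powR_ge0.
have A20 : 0 <= A2 by rewrite mulr_ge0// powR_ge0.
pose f (x : 'rV[R]_n) := (hkernel b x y `^ q * `|x| `^ (- c))%:E.
have f0 x : [set x : 'rV[R]_n | x != 0] x -> (0 <= f x)%E.
  by move=> _; rewrite lee_fin mulr_ge0// powR_ge0.
have cov x : [set x : 'rV[R]_n | x != 0] x ->
  [\/ (f x <= (A1 * `|x - 0| `^ (- c))%:E)%E /\ [set x : 'rV[R]_n | 0 < `|x - 0| <= K * r] x,
      (f x <= (A2 * `|x - y| `^ (- (b * q)))%:E)%E /\ [set x : 'rV[R]_n | 0 < `|x - y| <= r / 2] x |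
      (f x <= (r `^ q * `|x - 0| `^ (- a3))%:E)%E /\ [set x : 'rV[R]_n | K * r <= `|x - 0|] x].
  move=> /= x0; rewrite subr0.
  have [[le1 in1]|[[le2 in2]|[le3 in3]]] := hkernel0_pointwise c b0 q0 y0 x0.
  + by apply: Or31; split; rewrite ?lee_fin// normr_gt0 x0.
  + by apply: Or32; split; rewrite ?lee_fin.
  + by apply: Or33; split; rewrite ?lee_fin.
have := @integral_le_cover3 _ _ _ mu _ _ _ _ _ _ _ _ f0
  (mball 0 (K * r)) (mball y (r / 2)) (mext 0 (K * r))
  (mp 0 A1 (- c)) (mp y A2 (- (b * q))) (mp 0 (r `^ q) (- a3))
  (fun x => p0 0 A1 (- c) x A10) (fun x => p0 y A2 (- (b * q)) x A20)
  (fun x => p0 0 (r `^ q) (- a3) x (powR_ge0 _ _)) cov.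
move=> /le_trans; apply.
have sum3 (c1 c2 c3 X : R) :
    ((c1 + c2 + c3) * X)%:E = ((c1 * X)%:E + ((c2 * X)%:E + (c3 * X)%:E))%E.
  by rewrite -!EFinD; congr (_%:E); ring.
rewrite (sum3 `|C1| `|C2| `|C3|).
have K0' := ltW K0; have r0' : 0 <= r := ltW r0.
have abs_le (C X Y : R) : X <= C * Y -> 0 <= Y -> X <= `|C| * Y.
  by move=> h Y0; apply: le_trans h _; rewrite ler_wpM2r// ler_norm.
have rr s t : r `^ s * r `^ t = r `^ (s + t).
  by rewrite powRD// (gt_eqF r0) implybT.
apply: leeD; [|apply: leeD].
- apply: le_trans (ball_bound _ A10 bbq _) _; first by rewrite mulr_gt0.
  rewrite lee_fin; apply: abs_le; last exact: powR_ge0.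
  rewrite powRM// (_ : alpha * q = - (b * q) + (n%:R - c)); last by rewrite nq /c; ring.
  by rewrite -/c -/r -(rr (- (b * q)) (n%:R - c)) /C1 /A1 le_eqVlt; apply/orP; left; apply/eqP; ring.
- apply: le_trans (ball_bound _ A20 bq _) _; first by rewrite divr_gt0.
  rewrite lee_fin; apply: abs_le; last exact: powR_ge0.
  rewrite powRM ?invr_ge0// (_ : alpha * q = - c + (n%:R - b * q)); last by rewrite nq /c; ring.
  by rewrite -/c -/r -(rr (- c) (n%:R - b * q)) /C2 /A2 le_eqVlt; apply/orP; left; apply/eqP; ring.
- apply: le_trans (ext_bound _ (powR_ge0 _ _) a3n _) _; first by rewrite mulr_gt0.
  rewrite lee_fin; apply: abs_le; last exact: powR_ge0.
  rewrite (_ : 2 * (K * r) = 2 * K * r); last by ring.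
  rewrite powRM ?mulr_ge0//.
  rewrite (_ : alpha * q = q + (n%:R - a3)); last by rewrite nq /a3 /c; ring.
  by rewrite -/c -/r -(rr q (n%:R - a3)) /C3 le_eqVlt; apply/orP; left; apply/eqP; ring.
Qed.

End hkernel_integral.

(** * Cocanceling operators *)

Section test_vector_fields.
Context {R : realType} {n k : nat}.
Hypothesis n0 : (0 < n)%N.
Notation mu := (@lebesgue_rV R n).
Implicit Types (f : 'rV[R]_n -> 'cV[R[i]]_k).

Lemma vtest_continuous f : vtest_fun f ->
  forall j, continuous (fun x => complex.Re (f x j ord0)) /\
            continuous (fun x => complex.Im (f x j ord0)).
Proof. by move=> [cf _] j; have [] := cf j; split; exact: rsmooth_continuous. Qed.

Lemma vtest_measurable f : vtest_fun f ->
  forall j, measurable_fun setT (fun x => complex.Re (f x j ord0)) /\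
            measurable_fun setT (fun x => complex.Im (f x j ord0)).
Proof.
by move=> /vtest_continuous cf j; have [] := cf j; split; exact: continuous_measurable_rV.
Qed.

Lemma vtest_measurable_cnorm f : vtest_fun f -> measurable_fun setT (fun x => cnorm (f x)).
Proof. by move=> /vtest_continuous /continuous_cnorm; exact: continuous_measurable_rV. Qed.

Lemma vtest_bounded f : vtest_fun f -> exists M r : R, [/\ 0 < M, 0 < r,
  forall x, cnorm (f x) <= M & forall x, r < `|x| -> f x = 0].
Proof.
move=> tf; have [_ /compact_support_bounded[r r0 fr]] := tf.
have [x rx|M M0 HM] := continuous_bounded (continuous_cnorm (vtest_continuous tf)) (r := r).
  by rewrite fr// cnorm0.
exists M, r; split => // x; apply: le_trans (HM x); exact: ler_norm.
Qed.

Lemma vtest_integrable f (h : 'rV[R]_n -> R) (A : R) : vtest_fun f ->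
  measurable_fun setT h -> (forall x, `|h x| <= A) -> forall j,
    mu.-integrable setT (EFin \o (fun x => complex.Re (((h x)%:C%C *: f x) j ord0))) /\
    mu.-integrable setT (EFin \o (fun x => complex.Im (((h x)%:C%C *: f x) j ord0))).
Proof.
move=> tf mh hA j; have [M [r [M0 r0 fM fr]]] := vtest_bounded tf.
have [mR mI] := vtest_measurable tf j.
have A0 : 0 <= A := le_trans (normr_ge0 _) (hA 0).
split; (apply: (integrable_bounded_support (M := A * M) (r := r)) => //; first 1 last).
- exact: ltW.
- move=> x; rewrite mxE ReZ normrM ler_pM//.
  exact: le_trans (abs_Re_le_cnorm _ _) (fM x).
- by move=> x /fr->; rewrite !mxE mulr0.
- by under eq_fun do rewrite mxE ReZ; exact: measurable_funM.
- exact: ltW.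
- move=> x; rewrite mxE ImZ normrM ler_pM//.
  exact: le_trans (abs_Im_le_cnorm _ _) (fM x).
- by move=> x /fr->; rewrite !mxE mulr0.
- by under eq_fun do rewrite mxE ImZ; exact: measurable_funM.
Qed.

Lemma vtest_weighted_fin f (a : R) : vtest_fun f -> 0 <= a ->
  (\int[mu]_x (`|x| `^ a * cnorm (f x))%:E < +oo)%E.
Proof.
move=> tf a0; have [M [r [M0 r0 fM fr]]] := vtest_bounded tf.
have h0 x : 0 <= `|x| `^ a * cnorm (f x) by rewrite mulr_ge0 ?powR_ge0 ?cnorm_ge0.
have : mu.-integrable setT (EFin \o (fun x => `|x| `^ a * cnorm (f x))).
  apply: (integrable_bounded_support (M := r `^ a * M) (r := r)) => //.
  - apply: measurable_funM; last exact: vtest_measurable_cnorm.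
    exact: measurableT_comp (measurable_powR _) measurable_norm_rV.
  - exact: ltW.
  - move=> x; rewrite ger0_norm//; have [xr|/fr->] := leP `|x| r.
      apply: ler_pM; rewrite ?powR_ge0 ?cnorm_ge0//.
      by have r0' := ltW r0; apply: ge0_ler_powR; rewrite ?nnegrE.
    by rewrite cnorm0 mulr0 mulr_ge0 ?powR_ge0 ?ltW.
  - by move=> x /fr->; rewrite cnorm0 mulr0.
move=> /integrableP[_]; under eq_integral do rewrite /= ger0_norm//.
by [].
Qed.

End test_vector_fields.

(** In the equation tested against the monomial [d], the vector [u] occurs only in the term [g = d],
    so it can be isolated there. *)
Lemma mulmx_solve (R : rcfType) (I : finType) (p k s : nat) (L : I -> 'M[R[i]]_(p, k))
    (v : I -> 'cV[R[i]]_k) (u : 'cV[R[i]]_k) (e : R) (d : I) : e != 0 ->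
  (-1) ^+ s *: (\sum_g L g *m (v g + ((d == g)%:R * e)%:C%C *: u)) = 0 ->
  L d *m u = - (e^-1)%:C%C *: \sum_g L g *m v g.
Proof.
move=> e0 /eqP; rewrite scaler_eq0 signr_eq0/=.
under eq_bigr do rewrite mulmxDr -scalemxAr.
rewrite big_split/= [X in _ + X](bigD1 d)//= [X in _ + (_ + X)]big1; last first.
  by move=> g; rewrite eq_sym => /negbTE ->; rewrite mul0r scale0r.
rewrite addr0 eqxx mul1r addrC addr_eq0 => /eqP H.
have e0' : (e%:C)%C != 0 :> R[i] by rewrite (fmorph_eq0 (real_complex R)).
apply: (scalerI e0'); rewrite H scalerA mulrN -rmorphM/= divff//.
by rewrite scaleNr scale1r.
Qed.

Section cocanceling_operators.
Context {R : realType} {n m p k : nat} (L : diff_op R n m p k).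
Hypothesis n0 : (0 < n)%N.
Notation mu := (@lebesgue_rV R n).

(** A vector killed by all coefficients is killed by all symbols, hence is 0. So the row spaces of
    the coefficients together span everything, and the identity is a combination of their rows. *)
Lemma cocanceling_left_inverse : cocanceling L ->
  exists K : multiindex n m -> 'M[R[i]]_(k, p), \sum_g K g *m L g = 1%:M.
Proof.
move=> coL.
have ker (v : 'cV[R[i]]_k) : (forall g, L g *m v = 0) -> v = 0.
  move=> Lv; suff : [set 0] v by [].
  rewrite -coL => xi _ /=; rewrite mulmx_suml big1// => g _.
  by rewrite -scalemxAl Lv scaler0.
pose A := (\sum_g <<L g>>)%MS.
have Afull : row_full A.
  suff /eqP : cokermx A = 0.
    rewrite -mxrank_eq0 mxrank_coker subn_eq0 => kA.
    by rewrite /row_full eqn_leq rank_leq_col.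
  apply/matrixP => i j; rewrite [RHS]mxE.
  suff /colP/(_ i) : col j (cokermx A) = 0 by rewrite !mxE.
  apply: ker => g; rewrite colE mulmxA.
  have : (L g <= A)%MS.
    by apply: (submx_trans _ (sumsmx_sup g _ (submx_refl _))) => //; rewrite genmxE.
  by rewrite submxE => /eqP ->; rewrite mul0mx.
have /sub_sumsmxP[u uE] : (1%:M <= \sum_g <<L g>>)%MS by rewrite submx_full.
have /choice[D DE] : forall g, exists D, <<L g>>%MS = D *m L g.
  by move=> g; apply/submxP; rewrite genmxE.
exists (fun g => u g *m D g); rewrite uE; apply: eq_bigr => g _.
by rewrite DE mulmxA.
Qed.

Definition fact_prod (d : multiindex n m) : R := \prod_(i < n) (val d i)`!%:R.

(** The derivative of the test monomial minus its plateau part. The two agree for |y| < rho / 2 and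
    vanish for |y| > rho, so only the annulus remains. *)
Definition bump_error (d g : multiindex n m) rho y : R :=
  bumps d g rho y - (d == g)%:R * fact_prod d * cutoff rho y.

Lemma fact_prod_gt0 d : 0 < fact_prod d.
Proof. by apply: prodr_gt0 => i _; rewrite ltr0n fact_gt0. Qed.

Lemma bump_error_bound d g : exists2 C, 0 <= C & forall rho (y : 'rV[R]_n), 0 < rho ->
  `|bump_error d g rho y| <= C /\
  (~~ (rho / 2 <= `|y| <= rho) -> bump_error d g rho y = 0).
Proof.
have [M M0 HM] := @bumps_bounded R n m d g.
exists (M + fact_prod d); first by rewrite addr_ge0 ?ltW ?fact_prod_gt0.
move=> rho y r0; split.
  rewrite (le_trans (ler_normB _ _))// lerD// !normrM.
  rewrite (ger0_norm (ltW (fact_prod_gt0 d))) (ger0_norm (cutoff_ge0 _ _)).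
  rewrite -[leRHS]mulr1 ler_pM ?cutoff_le1 ?cutoff_ge0// ?mulr_ge0//.
    exact/ltW/fact_prod_gt0.
  by case: eqP => _; rewrite ?normr1 ?normr0 ?mul1r ?mul0r// ltW// fact_prod_gt0.
rewrite /bump_error negb_and -!ltNge => /orP[yr|yr].
  by rewrite bumps_near// cutoff1 ?mulr1 ?ltW// subrr.
by rewrite bumps0// cutoff0// mulr0 subrr.
Qed.

Lemma measurable_bump_error d g rho : measurable_fun setT (bump_error d g rho).
Proof.
apply: measurable_funB.
  by apply: continuous_measurable_rV; exact: continuous_bumps.
apply: measurable_funM => //.
by apply: continuous_measurable_rV; exact: continuous_cutoff.
Qed.

Lemma vintegral_mpartial_bump (d g : multiindex n m) f rho : vtest_fun f -> 0 < rho ->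
  vintegral (fun x => mpartial g (bump_test d rho) x *: f x) =
  vintegral (fun y => (bump_error d g rho y)%:C%C *: f y) +
  ((d == g)%:R * fact_prod d)%:C%C *: vintegral (fun y => (cutoff rho y)%:C%C *: f y)
  :> 'cV[R[i]]_k.
Proof.
move=> tf r0; have [C C0 HC] := bump_error_bound d g.
have cut1 (x : 'rV[R]_n) : `|cutoff rho x| <= 1 by rewrite ger0_norm ?cutoff_ge0 ?cutoff_le1.
have mcut : measurable_fun setT (@cutoff R n rho).
  by apply: continuous_measurable_rV; exact: continuous_cutoff.
set c := (d == g)%:R * fact_prod d.
rewrite -(vintegralZ _ (vtest_integrable n0 tf mcut cut1)) -vintegralD.
- congr vintegral; apply/funext => x.
  rewrite mpartial_bump_test// scalerA -scalerDl -rmorphM -rmorphD/=.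
  by rewrite /bump_error subrK.
- exact: (vtest_integrable n0 tf (measurable_bump_error d g rho) (fun x => (HC rho x r0).1)).
- have mc : measurable_fun setT (fun x : 'rV[R]_n => c * cutoff rho x) by exact: measurable_funM.
  have cc (x : 'rV[R]_n) : `|c * cutoff rho x| <= `|c| by rewrite normrM ler_piMr.
  have e (x : 'rV[R]_n) : c%:C%C *: ((cutoff rho x)%:C%C *: f x) = (c * cutoff rho x)%:C%C *: f x.
    by rewrite scalerA -rmorphM.
  move=> j; have [HR HI] := vtest_integrable n0 tf mc cc j.
  by split; [move: HR|move: HI]; congr (_.-integrable _ _); apply/funext => x /=; rewrite e.
Qed.

Lemma cutoff_moment_bound : cocanceling L -> exists2 C, 0 <= C &
  forall f : 'rV[R]_n -> 'cV[R[i]]_k, vtest_fun f -> distr_null L f ->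
  forall rho, 0 < rho ->
  ((l1norm (vintegral (fun y => (cutoff rho y)%:C%C *: f y)))%:E <=
   C%:E * \int[mu]_(y in [set y | rho / 2 <= `|y| <= rho]%R) (cnorm (f y))%:E)%E.
Proof.
move=> /cocanceling_left_inverse[K KL].
have /choice[CK HCK] : forall d, exists c, 0 <= c /\
    forall z : 'cV[R[i]]_p, l1norm (K d *m z) <= c * l1norm z.
  by move=> d; have [c c0 H] := l1norm_mulmx (K d); exists c.
have /choice[CL HCL] : forall g, exists c, 0 <= c /\
    forall z : 'cV[R[i]]_k, l1norm (L g *m z) <= c * l1norm z.
  by move=> g; have [c c0 H] := l1norm_mulmx (L g); exists c.
have /choice[CE HCE] : forall dg : multiindex n m * multiindex n m, exists c, 0 <= c /\
    forall rho (y : 'rV[R]_n), 0 < rho -> `|bump_error dg.1 dg.2 rho y| <= c /\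
  (~~ (rho / 2 <= `|y| <= rho) -> bump_error dg.1 dg.2 rho y = 0).
  by move=> [d g]; have [c c0 H] := bump_error_bound d g; exists c.
pose C := \sum_d CK d * ((fact_prod d)^-1 * \sum_g CL g * (2 * k.+1%:R * CE (d, g))).
exists C.
  apply: sumr_ge0 => d _; rewrite mulr_ge0 ?(HCK d).1// mulr_ge0//.
    by rewrite invr_ge0 ltW// fact_prod_gt0.
  by apply: sumr_ge0 => g _; rewrite mulr_ge0 ?(HCL g).1// mulr_ge0 ?(HCE (d, g)).1.
move=> f tf nf rho r0.
set u := vintegral _; set ann := [set y | _].
have mann : measurable ann.
  have -> : ann = (fun x : 'rV[R]_n => `|x| : R) @^-1` [set` `[(rho / 2), rho]].
    by apply/seteqP; split => x; rewrite /ann/= in_itv.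
  by rewrite -[X in measurable X]setTI; exact: measurable_norm_rV.
have mF := vtest_measurable_cnorm tf.
have F0 x : 0 <= cnorm (f x) by exact: cnorm_ge0.
set a := (\int[mu]_(y in ann) _)%E.
have a0 : (0 <= a)%E by apply: integral_ge0 => y _; rewrite lee_fin.
have afin : a \is a fin_num.
  rewrite ge0_fin_numE//; apply: le_lt_trans (vtest_weighted_fin n0 tf (lexx 0)).
  rewrite /a integral_mkcond; apply: ge0_le_integralW => y _.
    by apply: erestrict_ge0 => z _; rewrite lee_fin.
  by rewrite powRr0 mul1r patchE; case: ifP => // _; rewrite lee_fin.
pose vE d g := vintegral (fun y => (bump_error d g rho y)%:C%C *: f y).
have vE_le d g : l1norm (vE d g) <= 2 * k.+1%:R * CE (d, g) * fine a.
  have [c0 Hc] := HCE (d, g).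
  rewrite -lee_fin EFinM fineK//.
  apply: le_trans (l1norm_vintegral_le (measurable_bump_error d g rho) (vtest_measurable tf) mF) _.
  rewrite [leRHS](_ : _ = ((2 * k.+1%:R)%:E * ((CE (d, g))%:E * a))%E); last by rewrite muleA -EFinM.
  apply: lee_wpmul2l; first by rewrite lee_fin.
  rewrite -ge0_integralZl_EFin//; last 2 first.
  - by move=> x _; rewrite lee_fin.
  - by apply: measurable_funTS; exact/measurable_EFinP.
  rewrite [leRHS]integral_mkcond; apply: ge0_le_integralW => y _; first by rewrite lee_fin mulr_ge0.
  have [H1 H2] := Hc rho y r0.
  rewrite patchE; case: ifPn => [_|]; first by rewrite -EFinM lee_fin ler_wpM2r.
  by rewrite notin_setE /ann/= => /negP /H2 /= ->; rewrite normr0 mul0r.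
have Lu d : L d *m u = - ((fact_prod d)^-1)%:C%C *: \sum_g L g *m vE d g.
  apply: (mulmx_solve (s := m)); first by rewrite gt_eqF// fact_prod_gt0.
  apply: etrans (nf _ (bump_test_fun d r0)); congr (_ *: _); apply: eq_bigr => g _.
  by congr (_ *m _); rewrite vintegral_mpartial_bump.
(* The left inverse recovers the localized mean [u] from the vectors [L d *m u], each of which is a
   combination of integrals over the annulus. *)
have uE : u = \sum_d K d *m (- ((fact_prod d)^-1)%:C%C *: \sum_g L g *m vE d g).
  rewrite -[LHS]mul1mx -KL mulmx_suml; apply: eq_bigr => d _.
  by rewrite -mulmxA Lu.
rewrite -(fineK afin) -EFinM lee_fin uE.
rewrite (le_trans (l1norm_sum _ _ _))// /C mulr_suml; apply: ler_sum => d _.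
rewrite (le_trans ((HCK d).2 _))// -mulrA ler_wpM2l ?(HCK d).1//.
rewrite -rmorphN l1normZ normrN ger0_norm ?invr_ge0 ?(ltW (fact_prod_gt0 d))//.
rewrite -mulrA ler_wpM2l ?invr_ge0 ?(ltW (fact_prod_gt0 d))//.
rewrite (le_trans (l1norm_sum _ _ _))// mulr_suml; apply: ler_sum => g _.
rewrite (le_trans ((HCL g).2 _))// -[leRHS]mulrA ler_wpM2l ?(HCL g).1//.
Qed.

End cocanceling_operators.

(** * The weighted estimate for cocanceling operators *)

Section stein_weiss.
Context {R : realType} {n m p k : nat} (L : diff_op R n m p k).
Hypothesis n0 : (0 < n)%N.
Notation mu := (@lebesgue_rV R n).

Lemma measurable_riesz_kernel (b : R) (x : 'rV[R]_n) :
  measurable_fun [set: 'rV[R]_n] (fun y => (enorm (x - y) `^ b)^-1).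
Proof.
rewrite (_ : (fun y => _) = fun y => enorm (x - y) `^ (- b)); last first.
  by apply/funext => y; rewrite powRN.
apply: measurableT_comp (measurable_powR _) _.
apply: measurableT_comp measurable_enorm _.
by apply: measurable_subr_rV; [exact: measurable_cst|exact: measurable_id].
Qed.

(** The kernel is its remainder plus |x|^-b times the cutoff. The second part integrates to the
    localized mean at scale [radius x], whose annulus bound is again an integral against
    [hkernel0]. *)
Lemma riesz_pointwise (l : R) : l < n%:R -> cocanceling L -> exists2 C, 0 < C &
  forall f : 'rV[R]_n -> 'cV[R[i]]_k, vtest_fun f -> distr_null L f ->
  forall x, x != 0 ->
  ((cnorm (riesz_potential l f x))%:E <=
   C%:E * \int[mu]_y (hkernel0 (n%:R - l) (x, y) * cnorm (f y))%:E)%E.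
Proof.
move=> ln /(cutoff_moment_bound n0)[Cc Cc0 HCc].
set b := n%:R - l; have b0 : 0 < b by rewrite subr_gt0.
pose C1 := 1 + 2 `^ b + 3 * n%:R * b * 2 `^ (b + 1).
have C10 : 0 <= C1 by rewrite !addr_ge0 ?powR_ge0// !mulr_ge0 ?powR_ge0// ltW.
pose C2 := 2 * k.+1%:R * C1 + Cc * 2 `^ b.
have C20 : 0 <= C2 by rewrite addr_ge0 ?mulr_ge0 ?powR_ge0.
(* Adding 1 keeps the constant positive whatever the value of [riesz_const]. *)
exists (`|riesz_const n l| * C2 + 1); first by rewrite ltr_wpDl// mulr_ge0.
move=> f tf nf x x0.
have mF := vtest_measurable_cnorm tf.
have F0 y : 0 <= cnorm (f y) by exact: cnorm_ge0.
set B := (\int[mu]_y _)%E.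
have B0 : (0 <= B)%E.
  by apply: integral_ge0 => y _; rewrite lee_fin mulr_ge0 ?hkernel0_ge0.
have c0 : (0 < `|riesz_const n l| * C2 + 1) by rewrite ltr_wpDl// mulr_ge0.
(* An infinite [B] leaves nothing to prove; a finite one makes the remainder integrable against [f],
   so that the vector integral can be split. *)
have [Boo|Boo] := eqVneq B +oo%E; first by rewrite Boo gt0_muley ?leey// lte_fin.
have Bfin : B \is a fin_num by rewrite ge0_fin_numE// ltey.
have HE y : hkernel0 b (x, y) = hkernel b x y by rewrite /hkernel0/= (negbTE x0).
have mH : measurable_fun setT (fun y => hkernel0 b (x, y)).
  exact: measurableT_comp (measurable_hkernel0 b) (measurable_pair1 x).
have mHF : measurable_fun setT (fun y => (hkernel0 b (x, y) * cnorm (f y))%:E).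
  by apply/measurable_EFinP; exact: measurable_funM.
have x0' : 0 < `|x| by rewrite normr_gt0.
have rho0 : 0 < radius x by rewrite divr_gt0// mulr_gt0// ltr0n.
pose kx y := (enorm (x - y) `^ b)^-1.
pose a0 := enorm x `^ (- b).
pose r y := kx y - a0 * cutoff (radius x) y.
have mcut : measurable_fun setT (@cutoff R n (radius x)).
  by apply: continuous_measurable_rV; exact: continuous_cutoff.
have cut1 (y : 'rV[R]_n) : `|cutoff (radius x) y| <= 1.
  by rewrite ger0_norm ?cutoff_ge0 ?cutoff_le1.
have mkx : measurable_fun setT kx by exact: measurable_riesz_kernel.
have mr : measurable_fun setT r.
  by apply: measurable_funB => //; exact: measurable_funM.
have rF : (\int[mu]_y (`|r y| * cnorm (f y))%:E <= C1%:E * B)%E.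
  rewrite -ge0_integralZl_EFin//; last by move=> y _; rewrite lee_fin mulr_ge0 ?hkernel0_ge0.
  apply: ge0_le_integralW => y _; first by rewrite lee_fin mulr_ge0.
  rewrite -EFinM lee_fin mulrA ler_wpM2r// HE.
  exact: kernel_sub_cutoff.
have rint j : mu.-integrable setT (EFin \o (fun y => complex.Re (((r y)%:C%C *: f y) j ord0))) /\
              mu.-integrable setT (EFin \o (fun y => complex.Im (((r y)%:C%C *: f y) j ord0))).
  have [mR mI] := vtest_measurable tf j.
  have fin : (\int[mu]_y (`|r y| * cnorm (f y))%:E < +oo)%E.
    by apply: le_lt_trans rF _; rewrite -(fineK Bfin) -EFinM ltry.
  split; apply/integrableP; split.
  - apply/measurable_EFinP; under eq_fun do rewrite mxE ReZ; exact: measurable_funM.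
  - apply: le_lt_trans fin; apply: ge0_le_integralW => y _ //=.
    by rewrite mxE ReZ lee_fin normrM ler_wpM2l// abs_Re_le_cnorm.
  - apply/measurable_EFinP; under eq_fun do rewrite mxE ImZ; exact: measurable_funM.
  - apply: le_lt_trans fin; apply: ge0_le_integralW => y _ //=.
    by rewrite mxE ImZ lee_fin normrM ler_wpM2l// abs_Im_le_cnorm.
pose u := vintegral (fun y => (cutoff (radius x) y)%:C%C *: f y).
have kE : vintegral (fun y => (kx y)%:C%C *: f y) =
    vintegral (fun y => (r y)%:C%C *: f y) + a0%:C%C *: u.
  have ci := vtest_integrable n0 tf mcut cut1.
  rewrite /u -(vintegralZ _ ci) -vintegralD.
  - congr vintegral; apply/funext => y.
    by rewrite scalerA -scalerDl -rmorphM -rmorphD/= /r subrK.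
  - exact: rint.
  - have mc : measurable_fun setT (fun y : 'rV[R]_n => a0 * cutoff (radius x) y).
      by exact: measurable_funM.
    have cc (y : 'rV[R]_n) : `|a0 * cutoff (radius x) y| <= `|a0| by rewrite normrM ler_piMr.
    have e (y : 'rV[R]_n) : a0%:C%C *: ((cutoff (radius x) y)%:C%C *: f y) =
        (a0 * cutoff (radius x) y)%:C%C *: f y.
      by rewrite scalerA -rmorphM.
    move=> j; have [HR HI] := vtest_integrable n0 tf mc cc j.
    by split; [move: HR|move: HI]; congr (_.-integrable _ _); apply/funext => y /=; rewrite e.
have le1 : l1norm (vintegral (fun y => (r y)%:C%C *: f y)) <= 2 * k.+1%:R * C1 * fine B.
  rewrite -lee_fin EFinM fineK// EFinM -muleA.
  apply: le_trans (l1norm_vintegral_le mr (vtest_measurable tf) mF) _.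
  by apply: lee_wpmul2l => //; rewrite lee_fin.
have le2 : a0 * l1norm u <= Cc * 2 `^ b * fine B.
  rewrite -lee_fin [leRHS]EFinM fineK// EFinM [(Cc * _)%:E]EFinM -muleA.
  apply: le_trans (lee_wpmul2l _ (HCc f tf nf _ rho0)) _; first by rewrite lee_fin powR_ge0.
  rewrite [leLHS]muleCA; apply: lee_wpmul2l; first by rewrite lee_fin.
  rewrite -!ge0_integralZl_EFin ?powR_ge0//.
  - rewrite integral_mkcond; apply: ge0_le_integralW => y _.
      by apply: erestrict_ge0 => z _; rewrite mule_ge0 ?lee_fin ?powR_ge0.
    rewrite patchE; case: ifPn => [|_]; last first.
      by rewrite mule_ge0 ?lee_fin ?powR_ge0// mulr_ge0 ?hkernel0_ge0.
    rewrite inE/= => /andP[yl yr]; rewrite -!EFinM lee_fin mulrA ler_wpM2r// HE.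
    exact: hkernel_annulus.
  - by move=> y _; rewrite lee_fin mulr_ge0 ?hkernel0_ge0.
  - have -> : [set y : 'rV[R]_n | radius x / 2 <= `|y| <= radius x] =
        (fun x : 'rV[R]_n => `|x| : R) @^-1` [set` `[(radius x / 2), radius x]].
      by apply/seteqP; split => z /=; rewrite in_itv.
    by rewrite -[X in measurable X]setTI; exact: measurable_norm_rV.
  - by move=> y _; rewrite lee_fin.
  - by apply: measurable_funTS; exact/measurable_EFinP.
rewrite -(fineK Bfin) -EFinM lee_fin /riesz_potential cnormZ.
have fB : 0 <= fine B by rewrite fine_ge0.
rewrite mulrDl mul1r -mulrA ler_wpDr// ler_wpM2l//.
apply: le_trans (cnorm_le_l1norm _) _.
rewrite -[X in vintegral X]/(fun y => (kx y)%:C%C *: f y) kE.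
apply: le_trans (l1normD _ _) _; rewrite l1normZ ger0_norm ?powR_ge0//.
by rewrite /C2 mulrDl lerD.
Qed.

Lemma lebesgue_origin : mu [set 0] = 0%E.
Proof.
have -> : [set 0] = [set x : 'rV[R]_n | `|x - 0| <= 0].
  apply/seteqP; split => x /=; rewrite subr0; first by move=> ->; rewrite normr0.
  by rewrite normr_le0 => /eqP.
by apply: (etrans (lebesgue_ball_le 0 n0 (lexx 0))); rewrite mulr0 expr0n eqn0Ngt n0.
Qed.

(** The majorant is raised to +oo at the origin, a null set: it then dominates everywhere, stays
    measurable, and keeps its integral. *)
Lemma integral_le_off_origin (h g : 'rV[R]_n -> \bar R) :
  (forall x, 0 <= h x)%E -> measurable_fun setT g -> (forall x, 0 <= g x)%E ->
  (forall x : 'rV[R]_n, x != 0%R -> h x <= g x)%E -> (\int[mu]_x h x <= \int[mu]_x g x)%E.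
Proof.
move=> h0 mg g0 hg.
have m0 : measurable [set (0 : 'rV[R]_n)].
  have -> : [set 0] = (fun x : 'rV[R]_n => `|x| : R) @^-1` [set 0].
    apply/seteqP; split => x /=; first by move=> ->; rewrite normr0.
    by move/eqP; rewrite normr_eq0 => /eqP.
  by rewrite -[X in measurable X]setTI; apply: measurable_norm_rV.
pose oo := (cst +oo%E : 'rV[R]_n -> \bar R) \_ [set 0].
have oo0 x : (0 <= oo x)%E by apply: erestrict_ge0 => y _; exact: leey.
have moo : measurable_fun setT oo.
  apply: (measurable_restrictT (cst +oo%E : 'rV[R]_n -> \bar R) m0).1.
  exact: measurable_cst.
apply: (@le_trans _ _ (\int[mu]_x (g x + oo x))%E).
  apply: ge0_le_integralW => x _ //.
  have [->|x0] := eqVneq x 0; last by rewrite (le_trans (hg _ x0))// leeDl.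
  by rewrite /oo patchE mem_set//= addey ?leey// gt_eqF// (lt_le_trans _ (g0 _)).
rewrite ge0_integralD// [X in (_ + X)%E](_ : _ = 0)%E ?adde0//.
rewrite -integral_mkcond integral_cst//.
by rewrite [X in (_ * X)%E]lebesgue_origin mule0.
Qed.

Lemma stein_weiss_cocanceling (l alpha beta q : R) : l < n%:R ->
  0 <= alpha -> alpha < 1 -> 1 <= q -> beta < n%:R / q -> 0 < alpha + beta ->
  n%:R = q * (n%:R - l + alpha + beta) -> cocanceling L ->
  exists C : R, 0 < C /\
    forall f : 'rV[R]_n -> 'cV[R[i]]_k,
      vtest_fun f -> distr_null L f -> weighted_riesz_estimate l alpha beta q C f.
Proof.
move=> ln a0 a1 q1 bq ab nq coL; have q0 : 0 < q by lra.
set b := n%:R - l in nq; have b0 : 0 < b by rewrite subr_gt0.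
(* In view of [nq], this is the hypothesis alpha + beta > 0. *)
have bqn : b * q < n%:R by rewrite nq mulrC ltr_pM2l//; lra.
have betaqn : beta * q < n%:R by rewrite -ltr_pdivlMr.
have [C Cp HC] := riesz_pointwise ln coL.
have [C2 C20 HC2] := hkernel0_integral n0 b0 q0 bqn betaqn a1 nq.
(* The second factor is the cost of replacing the Euclidean weight by the sup-norm one, for either
   sign of [beta]. *)
pose K := C `^ q * n%:R `^ `|beta * q|.
have K0 : 0 <= K by rewrite mulr_ge0 ?powR_ge0.
exists ((K * C2) `^ q^-1 + 1); split; first by rewrite ltr_wpDl// powR_ge0.
move=> f tf nf; rewrite /weighted_riesz_estimate.
set M := (\int[mu]_x (`|x| `^ alpha * cnorm (f x))%:E)%E.
have F0 y : 0 <= cnorm (f y) by exact: cnorm_ge0.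
have M0 : (0 <= M)%E by apply: integral_ge0 => y _; rewrite lee_fin mulr_ge0 ?powR_ge0.
have Mfin : M \is a fin_num by rewrite ge0_fin_numE//; exact: vtest_weighted_fin.
have mpn (a : R) : measurable_fun setT (fun x : 'rV[R]_n => `|x| `^ a).
  exact: measurableT_comp (measurable_powR _) measurable_norm_rV.
(* A vanishing weight forces y = 0, where the kernel is 0. For alpha = 0 the premise never holds, as
   0 to the power 0 is 1. *)
have Hv0 (x y : 'rV[R]_n) : `|y| `^ alpha = 0 -> hkernel0 b (x, y) = 0.
  move=> /powR_eq0_eq0/eqP; rewrite normr_eq0 => /eqP ->.
  by rewrite /hkernel0/=; case: eqVneq => // x0; rewrite hkernel_origin.
have [g [mg g0] [gH gI]] := schur_majorant (mu := @lebesgue_rV R n) (nu := @lebesgue_rV R n)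
  (measurable_hkernel0 b) (mpn (- (beta * q))) (mpn alpha) (vtest_measurable_cnorm tf)
  (hkernel0_ge0 b) (fun x => powR_ge0 _ _) (fun y => powR_ge0 _ _) F0 q1 Hv0
  (esym (fineK Mfin)) C20 HC2.
have main : (\int[mu]_x (cnorm (riesz_potential l f x) `^ q * enorm x `^ (- (beta * q)))%:E <=
    (K * C2 * fine M `^ q)%:E)%E.
  apply: (@le_trans _ _ (\int[mu]_x (K%:E * g x))%E); last first.
    by rewrite ge0_integralZl_EFin// -mulrA [leRHS]EFinM; apply: lee_wpmul2l; rewrite ?lee_fin.
  apply: integral_le_off_origin.
  - by move=> x; rewrite lee_fin mulr_ge0 ?powR_ge0.
  - by apply: emeasurable_funM => //; exact: measurable_cst.
  - by move=> x; rewrite mule_ge0.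
  move=> x x0; have x0' : 0 < `|x| by rewrite normr_gt0.
  set B := (\int[mu]_y (hkernel0 b (x, y) * cnorm (f y))%:E)%E.
  have B0 : (0 <= B)%E.
    by apply: integral_ge0 => y _; rewrite lee_fin mulr_ge0 ?hkernel0_ge0.
  have h1 : ((cnorm (riesz_potential l f x) `^ q)%:E <= (C `^ q)%:E * B `^ q)%E.
    rewrite -!poweR_EFin -poweRM ?lee_fin ?(ltW Cp)//.
    apply: (gt0_ler_poweR (ltW q0)); last exact: HC.
      by rewrite in_itv/= leey andbT lee_fin cnorm_ge0.
    by rewrite in_itv/= leey andbT mule_ge0// lee_fin ltW.
  have h2 : enorm x `^ (- (beta * q)) <= n%:R `^ `|beta * q| * `|x| `^ (- (beta * q)).
    rewrite -[`|beta * q|]normrN; apply: powR_le_ratio => //.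
    - by rewrite ler1n.
    - exact: enorm_gt0.
    - rewrite ler_pdivrMr ?ltr0n// (le_trans (norm_le_enorm x))// ler_peMr ?ler1n//.
      exact: enorm_ge0.
    - exact: enorm_le_norm.
  apply: (@le_trans _ _ (((C `^ q)%:E * B `^ q) *
    (n%:R `^ `|beta * q| * `|x| `^ (- (beta * q)))%:E)%E).
    by rewrite EFinM; apply: lee_pmul => //; rewrite ?lee_fin ?powR_ge0.
  rewrite /K (EFinM (C `^ q)) (EFinM (n%:R `^ _)) -!muleA.
  apply: lee_wpmul2l; first by rewrite lee_fin powR_ge0.
  rewrite muleCA; apply: lee_wpmul2l; first by rewrite lee_fin powR_ge0.
  exact: gH.
apply: le_trans (gt0_ler_poweR _ _ _ main) _.
- by rewrite invr_ge0 ltW.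
- rewrite in_itv/= leey andbT; apply: integral_ge0 => x _.
  by rewrite lee_fin mulr_ge0 ?powR_ge0.
- by rewrite in_itv/= leey andbT lee_fin !mulr_ge0 ?powR_ge0.
rewrite poweR_EFin powRM ?mulr_ge0 ?powR_ge0// -powRrM divff ?gt_eqF//.
have fM : 0 <= fine M by rewrite fine_ge0.
rewrite powRr1// EFinM fineK//.
apply: (@le_trans _ _ ((((K * C2) `^ q^-1 + 1)%:E) * M)%E).
  by apply: lee_wpmul2r => //; rewrite lee_fin lerDl.
apply: lee_wpmul2l; first by rewrite lee_fin addr_ge0 ?powR_ge0.
apply: ge0_le_integralW => x _; first by rewrite lee_fin mulr_ge0 ?powR_ge0.
rewrite lee_fin ler_wpM2r//; apply: ge0_ler_powR => //; rewrite ?nnegrE ?enorm_ge0//.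
exact: norm_le_enorm.
Qed.

End stein_weiss.

(** * Necessity of cocancellation *)

Section gamma_positive.
Context {R : realType}.
Notation mu := (@lebesgue_measure R).

Let mu_ball (t : R) : 0 < t -> (mu [set x : R | `|x| <= t]%R <= (2 * t `^ 1)%:E)%E.
Proof.
move=> t0; have -> : [set x : R | `|x| <= t] = `[- t, t]%classic.
  by apply/seteqP; split => x /=; rewrite in_itv/= ler_norml.
rewrite lebesgue_measure_itv/= lte_fin gtrN// -EFinD lee_fin powRr1; [lra|exact: ltW].
Qed.

Let mnormR : measurable_fun setT (fun x : R => `|x|).
Proof.
by apply: continuous_measurable_fun => x; exact: (@norm_continuous _ R^o x).
Qed.

Let mpow (A a : R) : measurable_fun setT (fun x : R => (A * `|x| `^ a)%:E).
Proof.
apply/measurable_EFinP; apply: measurable_funM => //.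
exact: measurableT_comp (measurable_powR _) mnormR.
Qed.

(** On ]0, 1] the integrand is at most t^(s-1). Beyond 1, exp(-t) <= (N+1)! t^-(N+1) with N > s
    brings the exponent below -1. *)
Lemma gamma_integral_lty (s : R) : 0 < s ->
  (\int[mu]_(t in `]0%R, +oo[) (t `^ (s - 1) * expR (- t))%:E < +oo)%E.
Proof.
move=> s0.
pose N := Num.Def.archi_bound s.
have sN : s < N%:R by have := archi_boundP (ltW s0).
pose S1 := [set x : R | 0 < `|x| <= 1]; pose S2 := [set x : R | 1 <= `|x|].
have mS1 : measurable S1.
  have -> : S1 = (fun x : R => `|x|) @^-1` [set` `]0, 1]].
    by apply/seteqP; split => x; rewrite /S1/= in_itv.
  by rewrite -[X in measurable X]setTI; exact: mnormR.
have mS2 : measurable S2.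
  have -> : S2 = (fun x : R => `|x|) @^-1` [set` `[1, +oo[].
    by apply/seteqP; split => x; rewrite /S2/= in_itv/= andbT.
  by rewrite -[X in measurable X]setTI; exact: mnormR.
have cov x : (`]0%R, +oo[%classic : set R) x ->
  [\/ ((x `^ (s - 1) * expR (- x))%:E <= (1 * `|x| `^ (- (1 - s)))%:E)%E /\ S1 x,
      ((x `^ (s - 1) * expR (- x))%:E <= (N.+1`!%:R * `|x| `^ (- (N.+1%:R + 1 - s)))%:E)%E /\ S2 x |
      ((x `^ (s - 1) * expR (- x))%:E <= cst 0 x)%E /\ set0 x].
  rewrite /= in_itv/= andbT => x0.
  have [x1|x1] := leP x 1.
    apply: Or31; split; last by rewrite /S1/= gtr0_norm// x0.
    rewrite lee_fin mul1r opprB gtr0_norm// ler_piMr ?powR_ge0//.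
    by rewrite expR_le1 oppr_le0 ltW.
  apply: Or32; split; last by rewrite /S2/= gtr0_norm// ltW.
  rewrite lee_fin gtr0_norm// mulrC.
  rewrite (_ : - (N.+1%:R + 1 - s) = - N.+1%:R + (s - 1)); last by ring.
  have x0' := ltW x0.
  have -> : x `^ (- N.+1%:R + (s - 1)) = (x ^+ N.+1)^-1 * x `^ (s - 1).
    rewrite [LHS]powRD; last by apply/implyP => _; exact: lt0r_neq0.
    by rewrite [X in X * _ = _]powRN powR_mulrn.
  rewrite mulrA ler_wpM2r ?powR_ge0// expRN.
  rewrite ler_pdivlMr ?exprn_gt0// mulrC ler_pdivrMr ?expR_gt0//.
  rewrite mulrC -ler_pdivrMr ?ltr0n ?fact_gt0//.
  apply: le_trans (@expR_ge1Dxn R x N (ltW x0)); by rewrite lerDr.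
(* Two pieces suffice: the third is empty, with majorant 0. *)
apply: le_lt_trans (@integral_le_cover3 _ _ _ mu `]0%R, +oo[%classic S1 S2 set0 _ _ _ _ _ mS1 mS2 measurable0
  (mpow 1 (- (1 - s))) (mpow (N.+1`!%:R) (- (N.+1%:R + 1 - s))) (measurable_cst 0%E) _ _ _ cov) _.
- by move=> x _; rewrite lee_fin mulr_ge0 ?powR_ge0 ?expR_ge0.
- by move=> x; rewrite lee_fin mulr_ge0 ?powR_ge0.
- by move=> x; rewrite lee_fin mulr_ge0 ?powR_ge0.
- by [].
rewrite integral_set0 adde0; apply: lte_add_pinfty.
  under eq_integral do rewrite mul1r.
  apply: (@le_lt_trans _ _ (2 * 2 `^ `|1 - s| / (1 - 2^-1 `^ (1 - (1 - s))) * 1 `^ (1 - (1 - s)))%:E);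
    last exact: ltry.
  by apply: integral_le_ball => //; solve [exact: mnormR | exact: mu_ball | lra].
under eq_integral do rewrite EFinM.
rewrite ge0_integralZl_EFin//; last first.
  by apply: measurable_funTS; have := mpow 1 (- (N.+1%:R + 1 - s)); under eq_fun do rewrite mul1r.
apply: lte_mul_pinfty => //.
pose a := N.+1%:R + 1 - s; rewrite -/a.
have a1 : 1 < a by rewrite /a -natr1; lra.
apply: (@le_lt_trans _ _ (2 * 2 `^ `|a| / (1 - 2 `^ (1 - a)) * (2 * 1) `^ (1 - a))%:E);
  last exact: ltry.
by apply: integral_ge_ball => //; solve [exact: mnormR | exact: mu_ball].
Qed.

(** A real-valued integral is by convention 0 when the extended one is infinite, so positivity
    requires finiteness besides a lower bound, here taken on [1, 2]. *)
Lemma gamma_fun_gt0 (s : R) : 0 < s -> 0 < gamma_fun s.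
Proof.
move=> s0; rewrite /gamma_fun /Rintegral fine_gt0// gamma_integral_lty// andbT.
pose c := (2 `^ `|s - 1|)^-1 * expR (- 2).
have c0 : 0 < c by rewrite mulr_gt0 ?invr_gt0 ?powR_gt0 ?expR_gt0.
apply: (@lt_le_trans _ _ (\int[mu]_(t in `[1%R, 2%R]) c%:E)%E).
  rewrite integral_cst//= lebesgue_measure_itv/= lte_fin ltr1n -EFinD.
  by rewrite -EFinM lte_fin mulr_gt0//; lra.
rewrite [leLHS]integral_mkcond [leRHS]integral_mkcond; apply: ge0_le_integralW => x _.
  by apply: erestrict_ge0 => y _; rewrite lee_fin ltW.
rewrite !patchE; case: ifPn => [|_]; last first.
  by case: ifP => // _; rewrite lee_fin mulr_ge0 ?powR_ge0 ?expR_ge0.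
rewrite inE/= in_itv/= => /andP[x1 x2]; rewrite mem_set/=; last by rewrite in_itv/= andbT; lra.
rewrite lee_fin; apply: ler_pM; rewrite ?invr_ge0 ?powR_ge0 ?expR_ge0//; last by rewrite ler_expR; lra.
rewrite -[leLHS]mul1r ler_pdivrMr ?powR_gt0// mulrC -[leLHS]/((fun=> 1 : R) (s - 1)) -powR1.
by apply: powR_le_ratio; lra.
Qed.

Lemma riesz_const_gt0 (n : nat) (l : R) : 0 < l -> l < n%:R -> 0 < riesz_const n l.
Proof.
move=> l0 ln; rewrite /riesz_const divr_gt0 ?mulr_gt0 ?powR_gt0 ?pi_gt0 ?gamma_fun_gt0//; lra.
Qed.

End gamma_positive.

(** * From symbols to coefficients *)

Section monomials.
Context {R : realType} {n m : nat}.
Hypothesis n0 : (0 < n)%N.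

(** The inverse of the Vandermonde matrix with nodes 1, ..., m + 1: its columns are weights
    extracting one coefficient of a polynomial of degree at most [m] from its values. Nodes starting
    at 1 keep the later grid points away from 0. *)
Lemma vandermonde_dual : exists W : 'M[R]_m.+1, forall e d : 'I_m.+1,
  \sum_(t < m.+1) (t.+1%:R : R) ^+ e * W t d = (e == d)%:R.
Proof.
pose V : 'M[R]_m.+1 := Vandermonde m.+1 (\row_j (j.+1)%:R).
have uV : V \in unitmx.
  rewrite unitmxE det_Vandermonde unitfE; apply/prodf_neq0 => i _; apply/prodf_neq0 => j ij.
  by rewrite !mxE subr_eq0 eqr_nat eqSS gtn_eqF.
exists (invmx V) => e d.
have := mulmxV uV => /matrixP/(_ e d); rewrite !mxE => <-.
by apply: eq_bigr => t _; rewrite !mxE.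
Qed.

(** Products of the one-variable weights over the grid {1, ..., m+1}^n give a functional that is 1
    on the monomial [d] and 0 on the others; it is evaluated by exchanging the product with the sums
    over nodes. *)
Lemma monomials_independent (c : multiindex n m -> R[i]) :
  (forall xi : 'rV[R]_n, xi != 0 ->
     \sum_(g : multiindex n m) (\prod_(i < n) xi ord0 i ^+ val g i)%:C%C * c g = 0) ->
  forall g, c g = 0.
Proof.
have [W HW] := vandermonde_dual => Hc d.
pose pt (t : {ffun 'I_n -> 'I_m.+1}) : 'rV[R]_n := \row_i (t i).+1%:R.
pose w (t : {ffun 'I_n -> 'I_m.+1}) := \prod_i W (t i) (val d i).
have pt0 t : pt t != 0.
  apply/eqP => /rowP/(_ (Ordinal n0)); rewrite !mxE => /eqP.
  by rewrite pnatr_eq0.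
have dual (g : multiindex n m) :
    \sum_(t : {ffun 'I_n -> 'I_m.+1}) w t * \prod_(i < n) pt t ord0 i ^+ val g i = (g == d)%:R.
  rewrite (eq_bigr (fun t : {ffun 'I_n -> 'I_m.+1} =>
    \prod_i ((t i).+1%:R ^+ val g i * W (t i) (val d i)))); last first.
    by move=> t _; rewrite /w -big_split/=; apply: eq_bigr => i _; rewrite mxE mulrC.
  rewrite -(bigA_distr_bigA (fun (i : 'I_n) (t : 'I_m.+1) => t.+1%:R ^+ val g i * W t (val d i))).
  under eq_bigr do rewrite HW.
  have [->|gd] := eqVneq g d; first by rewrite big1// => i _; rewrite eqxx.
  have [i gi] : exists i, val g i != val d i.
    apply: contrapT => /forallNP h; move/eqP: gd; apply.
    by apply/val_inj/ffunP => i; apply/eqP/negPn/negP/h.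
  by rewrite (bigD1 i)//= (negbTE gi) mul0r.
have -> : c d = \sum_(g : multiindex n m) ((g == d)%:R : R)%:C%C * c g.
  rewrite (bigD1 d)//= eqxx mul1r big1 ?addr0// => g /negbTE ->.
  by rewrite mul0r.
under eq_bigr do rewrite -dual rmorph_sum mulr_suml.
rewrite exchange_big big1// => t _.
transitivity ((w t)%:C%C * \sum_(g : multiindex n m) (\prod_(i < n) pt t ord0 i ^+ val g i)%:C%C * c g).
  by rewrite mulr_sumr; apply: eq_bigr => g _; rewrite rmorphM mulrA.
by rewrite Hc ?mulr0.
Qed.

(** One nonzero vector is killed by all the symbols at once; each component of that relation is a
    polynomial identity in xi, so every coefficient kills the vector. *)
Lemma not_cocanceling_kernel p k (L : diff_op R n m p k) : ~ cocanceling L ->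
  exists2 v : 'cV[R[i]]_k, v != 0 & forall g, L g *m v = 0.
Proof.
move=> ncoL.
have [v [/= Lv v0]] : exists v : 'cV[R[i]]_k,
    (forall xi : 'rV[R]_n, xi != 0 -> symbol L xi *m v = 0) /\ v <> 0.
  apply: contrapT => /forallNP h; apply: ncoL; apply/seteqP; split => v /=.
    move=> Lv; apply: contrapT => v0; apply: (h v); split => // xi xi0; exact: Lv.
  by move=> -> xi _ /=; rewrite mulmx0.
exists v; first exact/eqP.
move=> g; apply/colP => i; rewrite [RHS]mxE.
apply: (monomials_independent (c := fun g => (L g *m v) i ord0)) => xi xi0.
transitivity ((symbol L xi *m v) i ord0); last by rewrite Lv// mxE.
rewrite /symbol mulmx_suml summxE; apply: eq_bigr => g' _.
by rewrite -scalemxAl [RHS]mxE.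
Qed.

End monomials.

(** * Cutoff fields of constant direction and failure of the estimate *)

Section cutoff_fields.
Context {R : realType} {n : nat}.
Hypothesis n0 : (0 < n)%N.
Notation mu := (@lebesgue_rV R n).

Lemma rsmoothM (a : R) (g : 'rV[R]_n -> R) : rsmooth g -> rsmooth (fun x => g x * a).
Proof.
move=> sg.
have pE s : partials s (fun x => g x * a) = (fun x => partials s g x * a).
  elim: s => //= i s ->; apply/funext => x; have [_ dg] := sg s.
  rewrite (_ : (fun x => partials s g x * a) = a \*: partials s g); last first.
    by apply/funext => y; rewrite /= mulrC.
  by rewrite deriveZ// mulrC.
move=> s; rewrite pE; have [cg dg] := sg s; split=> [x|i x].
  exact: (cvgM (cg x) (cvg_cst _)).
rewrite (_ : (fun x => partials s g x * a) = a \*: partials s g); last first.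
  by apply/funext => y; rewrite /= mulrC.
exact: derivableZ.
Qed.

Lemma rsmooth_cutoff : rsmooth (@cutoff R n 1).
Proof.
rewrite (_ : cutoff 1 = prodf (fun=> scaled_bump 0 1) (fun=> 0%N)); last first.
  apply/funext => y; apply: eq_bigr => i _.
  by rewrite /scaled_bump /bump derive1n0 !expr0 !mul1r.
by apply: rsmooth_prodf => i c t; exact: is_derive_scaled_bump.
Qed.

Section field.
Context {k : nat} (v : 'cV[R[i]]_k).

Let f (y : 'rV[R]_n) := (cutoff 1 y)%:C%C *: v.

Lemma vtest_cutoff_field : vtest_fun f.
Proof.
split=> [j|]; last first.
  by apply: (@compact_supportP _ _ _ _ 1) => x x1; rewrite /f cutoff0// scale0r.
split.
  under eq_fun do rewrite mxE ReZ; exact: rsmoothM rsmooth_cutoff.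
under eq_fun do rewrite mxE ImZ; exact: rsmoothM rsmooth_cutoff.
Qed.

Lemma vintegral_scale (c : 'rV[R]_n -> R[i]) :
  mu.-integrable setT (EFin \o (fun x => complex.Re (c x))) ->
  mu.-integrable setT (EFin \o (fun x => complex.Im (c x))) ->
  vintegral (fun x => c x *: v) = cintegral c *: v.
Proof.
move=> iR iI; apply/colP => j; rewrite !mxE.
have iZ (h : 'rV[R]_n -> R) (a : R) : mu.-integrable setT (EFin \o h) ->
    mu.-integrable setT (EFin \o (fun x => h x * a)).
  move=> ih; have := integrableZr measurableT a ih.
  by congr (_.-integrable _ _); apply/funext => x /=; rewrite EFinM.
rewrite /cintegral; under eq_Rintegral do rewrite mxE.
under [X in (_ +i* X)%C]eq_Rintegral do rewrite mxE.
move: (v j ord0) => [a b].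
have ReM z : complex.Re (z * (a +i* b)%C) = complex.Re z * a - complex.Im z * b by case: z.
have ImM z : complex.Im (z * (a +i* b)%C) = complex.Re z * b + complex.Im z * a by case: z.
apply/eqP; rewrite eq_complex ReM ImM/= -!RintegralZr//.
apply/andP; split; apply/eqP.
  rewrite -RintegralB//; [|exact: iZ..].
  by apply: eq_Rintegral => x _; rewrite ReM.
rewrite -RintegralD//; [|exact: iZ..].
by apply: eq_Rintegral => x _; rewrite ImM.
Qed.

(** The field has constant direction, so each vector integral is a scalar multiple of [v], which
    every coefficient kills. *)
Lemma distr_null_cutoff_field m p (L : diff_op R n m p k) :
  (forall g, L g *m v = 0) -> distr_null L f.
Proof.
move=> Lv phi [[sR sI] _]; rewrite big1 ?scaler0// => g _.
have ci (h : 'rV[R]_n -> R) : continuous h ->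
    mu.-integrable setT (EFin \o (fun x => h x * cutoff 1 x)).
  move=> ch; have cc : continuous (fun x => h x * cutoff 1 x).
    by move=> x; exact: (cvgM (ch x) (@continuous_cutoff R n 1 x)).
  have c0 (x : 'rV[R]_n) : 1 < `|x| -> h x * cutoff 1 x = 0.
    by move=> x1; rewrite cutoff0// mulr0.
  have [M _ HM] := continuous_bounded cc c0.
  apply: (integrable_bounded_support n0 _ ler01 HM c0).
  exact: continuous_measurable_rV.
have -> : (fun x => mpartial g phi x *: f x) =
    (fun x => (mpartial g phi x * (cutoff 1 x)%:C%C) *: v).
  by apply/funext => x; rewrite scalerA.
rewrite vintegral_scale.
- by rewrite -scalemxAr Lv scaler0.
- have := ci _ (sR (directions g)).1; congr (_.-integrable _ _).
  by apply/funext => x; rewrite /= mulr0 subr0.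
- have := ci _ (sI (directions g)).1; congr (_.-integrable _ _).
  by apply/funext => x; rewrite /= mulr0 add0r.
Qed.

(** For |x| > 2 and |y| <= 1 the Euclidean distance is at most 2 n |x|, so the kernel is at least (2
    n |x|)^-b on the support of the cutoff. Both the cutoff and the kernel are nonnegative, so
    nothing cancels. *)
Lemma riesz_cutoff_field_lower_bound (l : R) : v != 0 -> 0 < l -> l < n%:R ->
  exists2 c, 0 < c & forall x : 'rV[R]_n, 1 < `|x| - 1 ->
    c * `|x| `^ (- (n%:R - l)) <= cnorm (riesz_potential l f x).
Proof.
move=> v0 l0 ln; have rc0 := riesz_const_gt0 l0 ln.
set b := n%:R - l; have b0 : 0 < b by rewrite subr_gt0.
have cv0 : 0 < cnorm v.
  rewrite lt_neqAle cnorm_ge0 andbT eq_sym; apply: contra_neq v0 => cv.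
  apply/colP => j; rewrite mxE; apply/eqP; rewrite eq_complex/=.
  have := abs_Re_le_cnorm v j; have := abs_Im_le_cnorm v j.
  by rewrite cv !normr_le0 => -> ->.
have n1 : 1 <= n%:R :> R by rewrite ler1n.
have icut : mu.-integrable setT (EFin \o @cutoff R n 1).
  apply: (integrable_bounded_support (M := 1) n0 _ ler01) => [|x|x x1].
  - by apply: continuous_measurable_rV; exact: continuous_cutoff.
  - by rewrite ger0_norm ?cutoff_ge0 ?cutoff_le1.
  - exact: cutoff0.
pose I := (\int[mu]_y cutoff 1 y)%R.
have I0 : 0 < I.
  apply: (@lt_le_trans _ _ 1) => //; rewrite -lee_fin /I fineK; last exact: integrable_fin_num.
  (* The cutoff is 1 on the sup-norm ball of radius 1/2, a cube of side 1. *)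
  have -> : 1%E = mu [set y : 'rV[R]_n | `|y - 0| <= 2^-1].
    rewrite (lebesgue_ball_le 0 n0) ?invr_ge0// divff ?expr1n//.
  have mB : measurable [set y : 'rV[R]_n | `|y - 0| <= 2^-1].
    have -> : [set y : 'rV[R]_n | `|y - 0| <= 2^-1] =
        (fun x : 'rV[R]_n => `|x| : R) @^-1` [set` `]-oo, 2^-1]].
      by apply/seteqP; split => z /=; rewrite in_itv/= subr0.
    by rewrite -[X in measurable X]setTI; exact: measurable_norm_rV.
  rewrite -[leLHS]mul1e -integral_cst// integral_mkcond.
  apply: ge0_le_integralW => y _; first by apply: erestrict_ge0.
  rewrite patchE; case: ifPn => [|_]; last by rewrite lee_fin cutoff_ge0.
  by rewrite inE/= subr0 => y2; rewrite lee_fin cutoff1// div1r.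
exists (riesz_const n l * ((2 * n%:R) `^ (- b) * I * cnorm v)).
  have pn : 0 < (2 * n%:R) `^ (- b) by rewrite powR_gt0// mulr_gt0// (lt_le_trans ltr01).
  exact: mulr_gt0 rc0 (mulr_gt0 (mulr_gt0 pn I0) cv0).
move=> x x1; rewrite /riesz_potential cnormZ gtr0_norm//.
move: (riesz_const n l) rc0 => rc rc0; rewrite -!mulrA ler_pM2l//.
pose h y := (enorm (x - y) `^ b)^-1 * cutoff 1 y.
have x0 : 0 < `|x| by lra.
have bnd y : `|y| <= 1 -> 1 <= enorm (x - y) /\ enorm (x - y) <= 2 * n%:R * `|x|.
  move=> y1; have xy := ler_normB x y; have yx := lerB_dist x y; split.
    by apply: le_trans (norm_le_enorm _); lra.
  apply: le_trans (enorm_le_norm _) _; rewrite -mulrA mulrCA ler_wpM2l ?ler0n//; lra.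
have h0 y : 1 < `|y| -> h y = 0 by move=> y1; rewrite /h cutoff0// mulr0.
have ih : mu.-integrable setT (EFin \o h).
  apply: (integrable_bounded_support (M := 1) n0 _ ler01) => [|y|//].
    apply: measurable_funM; first exact: measurable_riesz_kernel.
    by apply: continuous_measurable_rV; exact: continuous_cutoff.
  have [y1|/h0 ->] := leP `|y| 1; last by rewrite normr0.
  have [e1 _] := bnd _ y1.
  rewrite /h normrM mulr_ile1// ger0_norm ?cutoff_ge0 ?cutoff_le1 ?invr_ge0 ?powR_ge0//.
  rewrite invf_le1 ?powR_gt0 ?(lt_le_trans ltr01)//.
  have -> : 1 = 1 `^ b :> R by rewrite powR1.
  by apply: ge0_ler_powR; rewrite ?nnegrE ?ler01 ?enorm_ge0// ltW.
have -> : (fun y => ((enorm (x - y) `^ b)^-1)%:C%C *: f y) = (fun y => (h y)%:C%C *: v).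
  by apply/funext => y; rewrite /f scalerA -rmorphM.
have iz : mu.-integrable setT (EFin \o (fun _ : 'rV[R]_n => 0 : R)) by exact: integrable0.
rewrite vintegral_scale//.
have -> : cintegral (fun y => (h y)%:C%C) = (\int[mu]_y h y)%R%:C%C.
  by rewrite /cintegral/= [X in (_ +i* X)%C](_ : _ = 0)// /Rintegral integral0.
rewrite cnormZ.
have hI : (2 * n%:R) `^ (- b) * `|x| `^ (- b) * I <= (\int[mu]_y h y)%R.
  rewrite /I -RintegralZl//; apply: le_Rintegral => //.
    have := integrableZl measurableT ((2 * n%:R) `^ (- b) * `|x| `^ (- b)) icut.
    by congr (_.-integrable _ _); apply/funext => y /=; rewrite EFinM.
  move=> y _; have [y1|y1] := leP `|y| 1; last by rewrite h0// cutoff0// mulr0.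
  have [e1 e2] := bnd _ y1.
  rewrite /h ler_wpM2r ?cutoff_ge0// -powRM ?mulr_ge0// -powRN.
  by apply: powR_antitone => //; [exact: ltW|exact: lt_le_trans e1].
apply: (@le_trans _ _ ((2 * n%:R) `^ (- b) * `|x| `^ (- b) * I * cnorm v)).
  by rewrite le_eqVlt; apply/orP; left; apply/eqP; ring.
by rewrite ler_wpM2r ?cnorm_ge0// (le_trans hI)// ler_norm.
Qed.

End field.

(* Each dyadic box contributes the same amount. *)
Lemma integral_critical_power (c : R) : 0 < c ->
  (\int[mu]_(x in [set x : 'rV[R]_n | (2 < `|x|)%R]) (c * `|x| `^ (- n%:R))%:E = +oo)%E.
Proof.
move=> c0.
have mS (P : R -> Prop) (A : set R) : measurable A -> (forall t, A t <-> P t) ->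
    measurable [set x : 'rV[R]_n | P `|x|].
  move=> mA AP.
  have -> : [set x : 'rV[R]_n | P `|x|] = (fun x : 'rV[R]_n => `|x| : R) @^-1` A.
    by apply/seteqP; split => z /= /AP.
  by rewrite -[X in measurable X]setTI; exact: measurable_norm_rV.
pose I0 j : set R := `[(2 ^+ j.+2), (2 ^+ j.+3)[%classic.
pose B j := [set x : 'rV[R]_n | forall i, I0 j (x ord0 i)].
pose g (x : 'rV[R]_n) : \bar R := (c * `|x| `^ (- n%:R))%:E.
have mI j : measurable (I0 j) by exact: measurable_itv.
have mB j : measurable (B j) by exact: (measurable_box (A := fun=> I0 j) (fun=> mI j)).
have mg : measurable_fun setT g.
  apply/measurable_EFinP; apply: measurable_funM => //.
  exact: measurableT_comp (measurable_powR _) measurable_norm_rV.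
have g0 x : (0 <= g x)%E by rewrite lee_fin mulr_ge0 ?powR_ge0 ?ltW.
have p0 j : 0 < (2 : R) ^+ j by rewrite exprn_gt0.
have muB j : mu (B j) = ((2 ^+ j.+2) ^+ n)%:E.
  rewrite (lebesgue_rV_box (A := fun=> I0 j)) => [|i]; last exact: mI.
  rewrite (eq_bigr (fun=> (2 ^+ j.+2)%:E)); last first.
    move=> i _; rewrite lebesgue_measure_itv/= lte_fin ltr_eXn2l ?ltr1n// ltnSn -EFinD.
    by congr (_%:E); rewrite [2 ^+ j.+3]exprS; ring.
  by rewrite prodEFin prodr_const card_ord.
have Bg j : ((c * 2^-1 ^+ n)%:E <= \int[mu]_(x in B j) g x)%E.
  apply: (@le_trans _ _ (\int[mu]_(x in B j) (c * (2 ^+ j.+3) `^ (- n%:R))%:E)%E).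
    rewrite integral_cst// [X in (_ * X)%E]muB -EFinM lee_fin -mulrA ler_pM2l//.
    rewrite powRN powR_mulrn; last exact: ltW.
    rewrite -exprVn -exprMn.
    have -> : (2 ^+ j.+3)^-1 * 2 ^+ j.+2 = 2^-1 :> R.
      by rewrite [2 ^+ j.+3]exprS invfM mulfVK// lt0r_neq0.
    by [].
  apply: ge0_le_integralW => x Bx; first by rewrite lee_fin mulr_ge0 ?powR_ge0 ?ltW.
  rewrite lee_fin ler_pM2l//; apply: powR_antitone => //.
    have := Bx (Ordinal n0); rewrite /I0/= in_itv/= => /andP[h _].
    apply: lt_le_trans (coord_le_norm x (Ordinal n0)).
    by rewrite normr_gt0 gt_eqF// (lt_le_trans _ h).
  apply: norm_le_coord => [|i]; first exact: ltW.
  have := Bx i; rewrite /I0/= in_itv/= => /andP[h h'].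
  by rewrite ger0_norm; [exact: ltW|exact: le_trans (ltW (p0 _)) h].
have tB : trivIset setT B.
  apply/trivIsetP.
  suff dis i j : (i < j)%N -> B i `&` B j = set0.
    move=> i j _ _; rewrite neq_ltn => /orP[/dis//|/dis]; by rewrite setIC.
  move=> ij; apply/seteqP; split => // x [/(_ (Ordinal n0)) + /(_ (Ordinal n0))].
  rewrite /I0/= !in_itv/= => /andP[_ xi] /andP[xj _].
  have : (2 : R) ^+ i.+3 <= 2 ^+ j.+2 by rewrite ler_eXn2l ?ltr1n.
  by move=> h; have := le_lt_trans (le_trans h xj) xi; rewrite ltxx.
have sub : \bigcup_j B j `<=` [set x : 'rV[R]_n | 2 < `|x|].
  move=> x [j _ /(_ (Ordinal n0))]; rewrite /I0/= in_itv/= => /andP[h _].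
  apply: lt_le_trans (coord_le_norm x (Ordinal n0)).
  apply: lt_le_trans (ler_norm _); apply: lt_le_trans h.
  by rewrite -[ltLHS]expr1 ltr_eXn2l ?ltr1n.
apply/eqyP => A A0.
pose K := Num.Def.archi_bound (A / (c * 2^-1 ^+ n)).
have a0 : 0 < c * 2^-1 ^+ n by rewrite mulr_gt0// exprn_gt0// invr_gt0.
have AK : A <= (c * 2^-1 ^+ n) * K%:R.
  rewrite -ler_pdivrMl// mulrC ltW// archi_boundP// divr_ge0 ?ltW//.
apply: (@le_trans _ _ (\int[mu]_(x in \bigcup_j B j) g x)%E); last first.
  apply: ge0_subset_integral => //.
  - exact: bigcup_measurable.
  - apply: (mS (fun t => 2 < t) `]2, +oo[%classic) => // t; by rewrite /= in_itv/= andbT.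
  - exact: measurable_funTS.
rewrite ge0_integral_bigcup//; last exact: measurable_funTS.
apply: le_trans (nneseries_lim_ge K _); last by move=> j _ _; exact: integral_ge0.
apply: (@le_trans _ _ (\sum_(0 <= j < K) (c * 2^-1 ^+ n)%:E)%E); last first.
  by apply: lee_sum => j _; exact: Bg.
rewrite sumEFin lee_fin sumr_const_nat subn0.
by move: AK; rewrite mulr_natr.
Qed.

(** With alpha = 0 the relation reads n = b q + beta q: the q-th power of the decay |x|^-b, times
    the weight, is exactly the critical power |x|^-n, while the right-hand side is finite. *)
Lemma riesz_estimate_cocanceling m p k (L : diff_op R n m p k) (l beta q : R) :
  0 < l -> l < n%:R -> 1 <= q -> n%:R = q * (n%:R - l + beta) ->
  (exists C : R, 0 < C /\ forall f : 'rV[R]_n -> 'cV[R[i]]_k,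
     vtest_fun f -> distr_null L f -> weighted_riesz_estimate l 0 beta q C f) ->
  cocanceling L.
Proof.
move=> l0 ln q1 nq [C [C0 HC]]; have q0 : 0 < q by lra.
apply: contrapT => /(not_cocanceling_kernel n0)[v v0 Lv].
have [c c0 Hc] := riesz_cutoff_field_lower_bound v0 l0 ln.
have tf := vtest_cutoff_field v.
have := HC _ tf (distr_null_cutoff_field Lv); rewrite /weighted_riesz_estimate.
set f := (fun y : 'rV[R]_n => _) in tf *.
set A := (\int[mu]_x _)%E; set B := (\int[mu]_x _)%E.
have Blt : (B < +oo)%E.
  apply: le_lt_trans (vtest_weighted_fin n0 tf (lexx 0)); apply: ge0_le_integralW => x _.
    by rewrite lee_fin mulr_ge0 ?powR_ge0 ?cnorm_ge0.
  by rewrite !powRr0.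
have B0 : (0 <= B)%E by apply: integral_ge0 => x _; rewrite lee_fin mulr_ge0 ?powR_ge0 ?cnorm_ge0.
suff -> : A = +oo%E.
  rewrite poweRyr ?gt_eqF ?invr_gt0// leye_eq => /eqP h.
  have : (C%:E * B < +oo)%E by apply: lte_mul_pinfty; rewrite ?lee_fin ?ltW.
  by rewrite h.
(* The lower bound of the potential raised to [q], divided by the cost of comparing the Euclidean
   weight with the sup-norm one. *)
pose c1 := c `^ q / n%:R `^ `|beta * q|.
have n1 : 1 <= n%:R :> R by rewrite ler1n.
have c10 : 0 < c1 by rewrite divr_gt0 ?powR_gt0// (lt_le_trans ltr01).
apply/eqP; rewrite -leye_eq -(integral_critical_power c10) integral_mkcond.
apply: ge0_le_integralW => x _.
  by apply: erestrict_ge0 => y _; rewrite lee_fin mulr_ge0 ?powR_ge0 ?ltW.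
rewrite patchE; case: ifPn => [|_]; last by rewrite lee_fin mulr_ge0 ?powR_ge0.
rewrite inE/= => x2; have x0 : 0 < `|x| by lra.
have x0' := ltW x0.
have x0n : x != 0 by rewrite -normr_gt0.
rewrite lee_fin (_ : - n%:R = - (n%:R - l) * q + - (beta * q)); last by lra.
rewrite powRD; last by apply/implyP => _; exact: lt0r_neq0.
rewrite powRrM /c1 mulrACA; apply: ler_pM; rewrite ?mulr_ge0 ?invr_ge0 ?powR_ge0//.
  rewrite -powRM ?powR_ge0 ?(ltW c0)//; apply: ge0_ler_powR; rewrite ?nnegrE ?cnorm_ge0//.
  - exact: ltW.
  - by rewrite mulr_ge0 ?powR_ge0 ?ltW.
  - by apply: Hc; lra.
rewrite [leLHS]mulrC ler_pdivrMr ?powR_gt0 ?(lt_le_trans ltr01)// [leRHS]mulrC -[`|beta * q|]normrN.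
apply: powR_le_ratio => //; first exact: enorm_gt0.
- by rewrite ler_pdivrMr ?(lt_le_trans ltr01)// mulrC; exact: enorm_le_norm.
- apply: (le_trans (norm_le_enorm x)); rewrite ler_peMl ?enorm_ge0//.
Qed.

End cutoff_fields.

Theorem theorem1p3 (R : realType) (N : nat) (l alpha beta q : R) (m p k : nat)
    (L : diff_op R N m p k) :
  (2 <= N)%N ->
  0 < l -> l < N%:R ->
  0 <= alpha -> alpha < 1 ->
  1 <= q ->
  beta < N%:R / q ->
  0 < alpha + beta ->
  q^-1 = 1 + (alpha + beta - l) / N%:R ->
  (cocanceling L ->
     exists C : R, 0 < C /\
       forall f : 'rV[R]_N -> 'cV[R[i]]_k,
         vtest_fun f -> distr_null L f ->
         weighted_riesz_estimate l alpha beta q C f)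
  /\
  (alpha = 0 ->
     (exists C : R, 0 < C /\
       forall f : 'rV[R]_N -> 'cV[R[i]]_k,
         vtest_fun f -> distr_null L f ->
         weighted_riesz_estimate l alpha beta q C f) ->
     cocanceling L).
Proof.
move=> N2 l0 lN a0 a1 q1 bq ab qE.
have N0 : (0 < N)%N by exact: leq_trans N2.
have NR : 0 < N%:R :> R by rewrite ltr0n.
have q0 : 0 < q by lra.
(* The scaling relation without denominators, the form in which both directions compare
   exponents. *)
have nq : N%:R = q * (N%:R - l + alpha + beta).
  have : N%:R * q^-1 = N%:R - l + alpha + beta.
    by rewrite qE; field; exact: lt0r_neq0.
  by move=> <-; rewrite mulrCA mulfV ?mulr1// gt_eqF.
split=> [|alpha0]; first exact: stein_weiss_cocanceling.
rewrite alpha0 addr0 in nq *.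
exact: (riesz_estimate_cocanceling N0 l0 lN q1 nq).
Qed.
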